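(* Let $\delta > 0$, $\epsilon > 0$ and $T > 0$. There exist positive constants $c_0 = c_0(\delta, \epsilon, T)$, $K_0 = K_0(\delta, \epsilon, T)$ and $N_0 = N_0(\delta, \epsilon, T)$, depending only on $\delta,\epsilon,T$, such that the following statements hold for all $\mathbf{v} \in S_\delta \cap \mathbb{Z}_{\ge N_0}^2$, $p \in [1, T \|\mathbf{v}\|]$, $w > 0$ and $z < 1$. (a) If $\epsilon \le w \le \zeta_{\mathbf{v}}-\min \{K_0 p^{1/3}\|\mathbf{v}\|^{-1/3}, \epsilon\}$ then $$\mathbf{E}[|G^{w, \mathrm{hor}}_{\mathbf{v}}-M^w_{\mathbf{v}}|^p] \ge c_0^p p^{p/2} (\zeta_{\mathbf{v}}-w)^{p/2}\|\mathbf{v}\|^{p/2}.$$ (b) If $\zeta_{\mathbf{v}}+\min \{K_0p^{1/3}\|\mathbf{v}\|^{-1/3}, \epsilon\} \le z \le 1-\epsilon$ then $$\mathbf{E}[|G^{z, \mathrm{ver}}_{\mathbf{v}}-M^z_{\mathbf{v}}|^p] \ge c_0^p p^{p/2} (z-\zeta_{\mathbf{v}})^{p/2}\|\mathbf{v}\|^{p/2}.$$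
   Context: $\mathrm{Exp}(\lambda)$ is the exponential distribution with rate $\lambda$. For $w>0$ and $z<1$, let $\{\omega^{w,z}_{\mathbf{v}}:\mathbf{v}\in\mathbb{Z}_{\ge0}^2\}$ be independent weights with $\omega^{w,z}_{\mathbf{v}}\sim\mathrm{Exp}(1)$ for $\mathbf{v}\in\mathbb{Z}_{>0}^2$, $\omega^{w,z}_{(i,0)}\sim\mathrm{Exp}(w)$ for $i\in\mathbb{Z}_{>0}$, $\omega^{w,z}_{(0,j)}\sim\mathrm{Exp}(1-z)$ for $j\in\mathbb{Z}_{>0}$, and $\omega^{w,z}_{(0,0)}=0$. $\Pi_{\mathbf{u},\mathbf{v}}$ is the set of up-right lattice paths from $\mathbf{u}$ to $\mathbf{v}$ with steps $(1,0)$ and $(0,1)$, viewed as vertex sets including both endpoints. Put $G^{w,\mathrm{hor}}_{\mathbf{v}}=\max_{\pi\in\Pi_{(1,0),\mathbf{v}}}\sum_{\mathbf{p}\in\pi}\omega^{w,z}_{\mathbf{p}}$ (which does not depend on $z$) and $G^{z,\mathrm{ver}}_{\mathbf{v}}=\max_{\pi\in\Pi_{(0,1),\mathbf{v}}}\sum_{\mathbf{p}\in\pi}\omega^{w,z}_{\mathbf{p}}$ (which does not depend on $w$), for $\mathbf{v}\in\mathbb{Z}_{>0}^2$. For $\mathbf{x}=(x,y)\in\mathbb{R}_{>0}^2$, $\zeta_{\mathbf{x}}=\frac{\sqrt{x}}{\sqrt{x}+\sqrt{y}}$, and $M^t_{\mathbf{x}}=\frac{x}{t}+\frac{y}{1-t}$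 for $t\in(0,1)$. $\|\cdot\|$ is the $L^1$ norm. $S_\delta = \{(x,y)\in\mathbb{R}_{>0}^2: x\ge \delta y,\ y\ge\delta x\}$, and $\mathbb{Z}_{\ge N}=\{n\in\mathbb{Z}: n\ge N\}$. *)

(* Defs.v *)
From HB Require Import structures.
From mathcomp Require Import all_boot all_order all_algebra.
From mathcomp Require Import all_classical all_reals all_analysis.
Set Implicit Arguments.
Unset Strict Implicit.
Unset Printing Implicit Defensive.
Import Order.TTheory GRing.Theory Num.Theory.
Local Open Scope classical_set_scope.
Local Open Scope ring_scope.

Section Geometry.
Context {R : realType}.
Implicit Types x : R * R.

Definition l1norm x : R := `|x.1| + `|x.2|.

Definition zeta x : R := Num.sqrt x.1 / (Num.sqrt x.1 + Num.sqrt x.2).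

(* Only meaningful for 0 < t < 1. *)
Definition Mfun (t : R) x : R := x.1 / t + x.2 / (1 - t).

Definition cone (delta : R) : set (R * R) :=
  [set x | [/\ 0 < x.1, 0 < x.2, delta * x.2 <= x.1 & delta * x.1 <= x.2]].

Definition pt (v : nat * nat) : R * R := (v.1%:R, v.2%:R).

End Geometry.

Definition up_right : rel (nat * nat) :=
  [rel p q | (q == (p.1.+1, p.2)) || (q == (p.1, p.2.+1))].

(* A path is represented by the list of its vertices, both endpoints included;
   the vertices are pairwise distinct (see [uniq_up_right_path]), so summing
   over the list is summing over the vertex set. *)
Definition up_right_paths (u v : nat * nat) : set (seq (nat * nat)) :=
  [set u :: s | s in [set s | path up_right u s /\ last u s = v]].

(* The supremum is a maximum whenever u <= v coordinatewise (see [lpp_max]). *)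
Definition lpp {R : realType} (wt : nat * nat -> R) (u v : nat * nat) : R :=
  sup [set \sum_(p <- pi) wt p | pi in up_right_paths u v].

Section Probability.
Context {R : realType} {d : measure_display} {Omega : measurableType d}.
Variable P : probability Omega R.

Definition mutually_independent (I : choiceType) (X : I -> {RV P >-> R}) :=
  forall (s : seq I) (A : I -> set R), uniq s ->
    (forall i, i \in s -> measurable (A i)) ->
    P (\big[setI/setT]_(i <- s) (X i @^-1` A i)) =
    (\prod_(i <- s) P (X i @^-1` A i))%E.

Definition exponentially_distributed (rate : R) (X : {RV P >-> R}) :=
  forall A : set R, measurable A -> distribution P X A = exponential_prob rate A.

Record is_boundary_weights (w z : R) (om : nat * nat -> {RV P >-> R}) : Prop :=
  IsBoundaryWeights {
    weights_indep : mutually_independent om;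
    weights_bulk : forall i j : nat, (0 < i)%N -> (0 < j)%N ->
      exponentially_distributed 1 (om (i, j));
    weights_hor : forall i : nat, (0 < i)%N ->
      exponentially_distributed w (om (i, 0%N));
    weights_ver : forall j : nat, (0 < j)%N ->
      exponentially_distributed (1 - z) (om (0%N, j));
    weights_origin : forall t, om (0%N, 0%N) t = 0 }.

Definition Ghor (om : nat * nat -> {RV P >-> R}) (v : nat * nat) (t : Omega) :=
  lpp (fun p => om p t) (1%N, 0%N) v.

Definition Gver (om : nat * nat -> {RV P >-> R}) (v : nat * nat) (t : Omega) :=
  lpp (fun p => om p t) (0%N, 1%N) v.

End Probability.

Lemma up_right_sum p q : up_right p q -> (q.1 + q.2 = (p.1 + p.2).+1)%N.
Proof. by move=> /orP[] /eqP -> /=; rewrite ?addnS. Qed.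

Lemma up_right_last u s : path up_right u s ->
  ((last u s).1 + (last u s).2 = u.1 + u.2 + size s)%N.
Proof.
elim: s u => [|q s IH] u /=; first by rewrite addn0.
by move=> /andP[/up_right_sum h /IH ->]; rewrite h addnS.
Qed.

Lemma uniq_up_right_path u v pi : up_right_paths u v pi -> uniq pi.
Proof.
move=> [s [us _] <-].
apply: (@map_uniq _ _ (fun p => p.1 + p.2)%N).
apply: (sorted_uniq ltn_trans ltnn).
rewrite [sorted _ _]path_map; apply: sub_path us => p q /up_right_sum /= ->.
exact: ltnSn.
Qed.

Lemma finite_up_right_paths u v : finite_set (up_right_paths u v).
Proof.
apply: finite_image.
suff fin n : forall u, finite_set [set s | path up_right u s /\ size s = n].
  apply: sub_finite_set (fin (v.1 + v.2 - (u.1 + u.2))%N u) => s /= [us <-].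
  by split=> //; rewrite (up_right_last us) addKn.
elim: n => [|n IH] {}u.
  apply: (@sub_finite_set _ _ [set [::]]) => // s /= [_ /size0nil ->] //.
apply: (@sub_finite_set _ _
  (cons (u.1.+1, u.2) @` [set s | path up_right (u.1.+1, u.2) s /\ size s = n]
   `|` cons (u.1, u.2.+1) @`
     [set s | path up_right (u.1, u.2.+1) s /\ size s = n])).
  by move=> [|q s] [] //= /andP[/orP[]/eqP -> us] [sn]; [left|right]; exists s.
by rewrite finite_setU; split; apply: finite_image.
Qed.

Lemma up_right_paths_neq0 u v : (u.1 <= v.1)%N -> (u.2 <= v.2)%N ->
  up_right_paths u v !=set0.
Proof.
move: u v => [a b] [c e] /= /subnKC <- /subnKC <-.
suff [s hs] : [set s | path up_right (a, b) s /\
    last (a, b) s = (a + (c - a), b + (e - b))%N] !=set0.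
  by exists ((a, b) :: s), s.
move: (c - a)%N (e - b)%N => k0 l0.
elim: k0 a => [|k IH] a1; last first.
  have [s [h1 h2]] := IH a1.+1.
  exists ((a1.+1, b) :: s); split=> /=; first by rewrite h1 andbT /up_right /= eqxx.
  by rewrite h2 addnS addSn.
elim: l0 b => [|l IH] b1; first by exists [::]; split; rewrite //= !addn0.
have [s [h1 h2]] := IH b1.+1.
exists ((a1, b1.+1) :: s); split=> /=.
  by rewrite h1 andbT /up_right /= eqxx orbT.
by rewrite h2 addnS addSn.
Qed.

Lemma lpp_max (R : realType) (wt : nat * nat -> R) (u v : nat * nat) :
  (u.1 <= v.1)%N -> (u.2 <= v.2)%N ->
  (exists2 pi, up_right_paths u v pi & lpp wt u v = \sum_(p <- pi) wt p) /\
  (forall pi, up_right_paths u v pi -> \sum_(p <- pi) wt p <= lpp wt u v).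
Proof.
move=> h1 h2; set S := [set \sum_(p <- pi) wt p | pi in up_right_paths u v].
have fS : finite_set S by apply: finite_image; exact: finite_up_right_paths.
have S0 : S !=set0 by have [pi] := up_right_paths_neq0 h1 h2; exists (\sum_(p <- pi) wt p), pi.
have [m Sm mmax] : exists2 m, S m & forall x, S x -> x <= m.
  move: S0; have /finite_seqP[r ->] := fS.
  elim: r => [|a r IH] [x] //= _.
  case: r IH => [|b r] IH.
    by exists a => [|y]; rewrite /= inE // => /eqP ->.
  have [|m mr mM] := IH; first by exists b; rewrite /= inE eqxx.
  exists (Num.max a m) => [|y] /=.
    by rewrite inE; case: leP => _; rewrite ?eqxx ?mr ?orbT.
  by rewrite inE le_max => /orP[/eqP ->|/mM ->]; rewrite ?lexx ?orbT.
have ubS : has_ubound S by exists m => x; exact: mmax.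
have lppE : lpp wt u v = m.
  by apply/eqP; rewrite eq_le; apply/andP; split; [exact: ge_sup|exact: ub_le_sup].
split; first by have [pi ppi pim] := Sm; exists pi; rewrite // pim.
by move=> pi ppi; rewrite lppE; apply: mmax; exists pi.
Qed.

(* Main.v *)
Require Import Defs.
From HB Require Import structures.
From mathcomp Require Import all_boot all_order all_algebra.
From mathcomp Require Import all_classical all_reals all_analysis measurable_realfun.
From mathcomp Require Import zify ring lra.
Set Implicit Arguments.
Unset Strict Implicit.
Unset Printing Implicit Defensive.
Import Order.TTheory GRing.Theory Num.Theory.
Import numFieldNormedType.Exports.
Local Open Scope classical_set_scope.
Local Open Scope ring_scope.

(** Write [M] for the mean function at [w], [N] for the norm of the endpoint
    and [Delta] for [zeta - w].  The idea is to compare the passage time [G] with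
    horizontal boundary rate [w] to the stationary one, which also has a vertical
    boundary, of rate [1 - w].

    Stationarity.  Across a unit cell, a horizontal increment of law Exp(w), a
    vertical one of law Exp(1 - w) and the weight of law Exp(1) produce new
    increments with the same joint law ([burke_step]).  Sweeping a rectangle cell
    by cell, the increments along its north side are independent Exp(w) variables
    ([north_increments]).  So the stationary passage time has mean [M], and after
    a change of the rate of the vertical boundary the exponential moment
    E exp ((w - z) G^{w,z}) is explicit ([mgf_boundary]).

    Lower tail, at scale sqrt (N Delta).  The stationary passage time is at most
    the maximum of the horizontal and the vertical one.  By the exponential
    moments, the upper deviations of the horizontal one have order
    sqrt (N Delta); the vertical one lies below [M] by order N Delta^2, which is
    much more when N Delta^3 is large, so it hardly contributes.  As the maximum
    has mean at least [M], the horizontal passage time cannot be below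
    M - s sqrt (N Delta) with probability larger than 1/4
    ([stationary_bound], [hor_lower_tail], [lower_tail_parameters]).

    Upper tail.  For [k] of order N Delta, [G] is at least the sum of the first
    [k] horizontal weights plus the passage time of the rectangle without its
    first [k] columns, to which the lower tail estimate still applies.  Lowering
    the rates of these [k] weights by theta, of order sqrt (q / (N Delta)), lifts
    their sum by more than D = sqrt (q N Delta), while the second moment of the
    density of this change of measure is only exp (O(q)).  Cauchy-Schwarz then
    bounds the probability of the event G >= M + D from below by exp (- C q) / 4
    ([upper_tail_lower_bound], [hor_upper_tail]).  Under the changed measure each
    of the two lower bounds, for the sum and for the shifted passage time, holds
    with probability at least 3/4, so that a union bound combines them.

    With q the minimum of p and a small multiple of N, this single event gives
    the p-th moment in (a) ([hor_moment]); (b) is its image under the reflection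
    exchanging the two axes. *)

(** * Measures with a density *)

Section density.
Context d (T : measurableType d) (R : realType).
Local Open Scope ereal_scope.
Import HBNNSimple.

(** Stated existentially, because the set function is a measure only under the
    hypotheses on [g], which differ from one use to the next. *)
Lemma density_measure (Q : {measure set T -> \bar R}) (g : T -> R) :
  measurable_fun [set: T] g -> (forall t, 0 <= g t)%R ->
  exists Q' : {measure set T -> \bar R},
    (forall A, measurable A -> Q' A = \int[Q]_(t in A) (g t)%:E) /\
    forall f : T -> \bar R, measurable_fun [set: T] f -> (forall t, 0 <= f t) ->
      \int[Q']_t f t = \int[Q]_t ((g t)%:E * f t).
Proof.
move=> mg g0.
have mge : measurable_fun [set: T] (EFin \o g) by exact/measurable_EFinP.
have ge0 t : 0 <= (g t)%:E by rewrite lee_fin.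
pose nu A := \int[Q]_(t in A) (g t)%:E.
have nu0 : nu set0 = 0 by rewrite /nu integral_set0.
have nu_ge0 A : 0 <= nu A by apply: integral_ge0.
have nu_additive : semi_sigma_additive nu.
  move=> /= F mF tF mUF; rewrite /nu; apply: cvg_toP.
    apply: ereal_nondecreasing_is_cvgn => m n mn.
    by apply: lee_sum_nneg_natr => // k _ _; apply: integral_ge0.
  by rewrite ge0_integral_bigcup//; exact: measurable_funTS.
pose Nu : {measure set T -> \bar R} :=
  HB.pack nu (isMeasure.Build _ _ _ nu nu0 nu_ge0 nu_additive).
exists Nu; split=> // f mf f0.
have simple (h : {nnsfun T >-> R}) :
    \int[Nu]_t (h t)%:E = \int[Q]_t ((g t)%:E * (h t)%:E).
  under eq_integral do rewrite fimfunE -fsumEFin//.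
  rewrite ge0_integral_fsum//; last 2 first.
    by move=> r; exact/measurable_EFinP/measurable_funM.
    by move=> r t _; rewrite nnfun_muleindic_ge0.
  under [RHS]eq_integral.
    move=> t _; rewrite fimfunE -fsumEFin// ge0_mule_fsumr; last first.
      by move=> r; rewrite nnfun_muleindic_ge0.
    over.
  rewrite ge0_integral_fsum//; last 2 first.
    move=> r; apply: emeasurable_funM => //.
    by apply/measurable_EFinP/measurable_funM.
    by move=> r t _; rewrite mule_ge0// nnfun_muleindic_ge0.
  apply: eq_fsbigr => r /[!inE] -[t _ rE].
  have r0 : (0 <= r)%R by rewrite -rE.
  under eq_integral do rewrite EFinM.
  rewrite integralZl_indic_nnsfun// integral_indic//= setIT.
  under [RHS]eq_integral do rewrite EFinM muleCA.
  rewrite ge0_integralZl//; last 2 first.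
    apply: emeasurable_funM => //; exact/measurable_EFinP.
    by move=> ? _; rewrite mule_ge0// lee_fin.
  congr (_ * _); rewrite -[X in nu X]setTI /nu integral_mkcondr.
  by apply: eq_integral => u _; rewrite epatch_indic.
pose h := nnsfun_approx measurableT mf.
have h_cvg t : (h n t)%:E @[n --> \oo] --> f t by exact: cvg_nnsfun_approx.
have h_nd t : {homo (fun n => (h n t)%:E) : m n / (m <= n)%N >-> m <= n}.
  by move=> m n mn; rewrite lee_fin; exact/lefP/nd_nnsfun_approx.
transitivity (limn (fun n => \int[Nu]_t (h n t)%:E)).
  rewrite -monotone_convergence//.
  - by apply: eq_integral => t _; apply/esym/cvg_lim.
  - by move=> n; exact/measurable_EFinP.
  - by move=> n t _; rewrite lee_fin.
transitivity (limn (fun n => \int[Q]_t ((g t)%:E * (h n t)%:E))).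
  by congr (limn _); apply/funext => n; exact: simple.
rewrite -monotone_convergence//.
- by apply: eq_integral => t _; apply/cvg_lim => //; exact: cvgeZl.
- by move=> n; apply: emeasurable_funM => //; exact/measurable_EFinP.
- by move=> n t _; rewrite mule_ge0// lee_fin.
- by move=> t _ m n mn; rewrite lee_wpmul2l// h_nd.
Qed.

End density.

(** * The exponential distribution and the law of a Burke cell *)

Section real_laws.
Context {R : realType}.
Local Open Scope ereal_scope.

(** Open right half-lines form a generating pi-system, so that laws can be
    compared through their tails, which are explicit for exponential variables. *)
Lemma measure_unique_itvoy (m1 m2 : {measure set (measurableTypeR R) -> \bar R}) :
  m1 setT < +oo -> (forall x : R, m1 `]x, +oo[%classic = m2 `]x, +oo[%classic) ->
  forall A, measurable A -> m1 A = m2 A.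
Proof.
move=> m1_fin m12 A mA.
apply: (@measure_unique _ R (measurableTypeR R) (@RGenOInfty.G R)
  (fun n => `](- n%:R)%R, +oo[%classic)) => //.
- exact: (RGenOInfty.measurableE R).
- move=> _ _ [x ->] [y ->]; exists (Num.max x y).
  rewrite predeqE => t /=; rewrite !in_itv/= !andbT gt_max; split.
    by move=> [-> ->].
  by move=> /andP[-> ->].
- by move=> n; exists (- n%:R)%R.
- rewrite predeqE => t /=; split=> // _.
  exists (Num.truncn `|t|).+1 => //=; rewrite in_itv/= andbT ltrNl.
  by rewrite (@le_lt_trans _ _ `|t|%R)// ?truncnS_gt// -normrN ler_norm.
- by move=> _ [x ->].
- move=> k; rewrite (le_lt_trans _ m1_fin)// le_measure// inE//.
Qed.

Lemma exponential_probability (r : R) : (0 < r)%R ->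
  exists mu : probability (measurableTypeR R) R,
    forall A, mu A = exponential_prob r A.
Proof.
move=> r0.
exists (exponential_distribution_exponential_prob__canonical__probability_measure_Probability r0).
by [].
Qed.

Lemma integral_exponential (r : R) (mu : {measure set (measurableTypeR R) -> \bar R})
    (f : measurableTypeR R -> \bar R) :
  (0 < r)%R -> (forall A, measurable A -> mu A = exponential_prob r A) ->
  measurable_fun setT f -> (forall x, 0 <= f x) ->
  \int[mu]_x f x = \int[lebesgue_measure]_x ((exponential_pdf r x)%:E * f x).
Proof.
move=> r0 muE mf f0.
have [|x|mu' [mu'E mu'int]] :=
    @density_measure _ _ R (@lebesgue_measure R) (exponential_pdf r).
- exact: measurable_exponential_pdf.
- exact/exponential_pdf_ge0/ltW.
rewrite -mu'int//.
apply: eq_measure_integral => A mA _.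
by rewrite muE// mu'E.
Qed.

Lemma exponential_tail (r x : R) : (0 < r)%R ->
  exponential_prob r `]x, +oo[%classic = (expR (- r * Num.max x 0))%:E.
Proof.
move=> r0; have [mu muE] := exponential_probability r0; rewrite -muE.
have tail y : (0 <= y)%R -> mu `]y, +oo[%classic = (expR (- r * y))%:E.
  move=> y0; rewrite muE /exponential_prob integral_itv_obnd_cbnd; last first.
    apply/measurable_EFinP/measurable_funTS; exact: measurable_exponential_pdf.
  rewrite (@ge0_continuous_FTC2y _ _ (fun x => - expR (- r * x))%R _ 0)//.
  - by rewrite EFinN oppeK add0e.
  - by move=> z _; exact/exponential_pdf_ge0/ltW.
  - apply: (@continuous_subspaceW R^o _ _ [set` `[0%R, +oo[%R]).
      by move=> z /=; rewrite !in_itv/= !andbT; exact: le_trans.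
    exact: within_continuous_exponential_pdf.
  - rewrite -oppr0; apply: cvgN.
    under eq_fun do rewrite mulNr.
    apply: (@cvg_comp _ _ _ (fun z => r * z)%R (fun z => expR (- z)) _ (pinfty_nbhs R));
      last exact: cvgr_expR.
    exact: gt0_cvgMry.
  - apply: cvgN; apply/cvg_at_right_filter.
    apply: continuous_comp; last exact: continuous_expR.
    by apply: continuousM => //; apply: (@continuousN _ R^o); exact: cst_continuous.
  - move=> z zy; apply: derive1_exponential_pdf.
    by move: zy; rewrite !in_itv/= !andbT; exact: le_lt_trans.
have [x0|x0] := leP 0%R x; first by rewrite tail.
rewrite -tail//.
apply/eqP; rewrite eq_le; apply/andP; split.
  by rewrite [leRHS]tail// mulr0 expR0 probability_le1.
rewrite le_measure ?inE// => z /=; rewrite !in_itv/= !andbT; exact: lt_trans.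
Qed.

Lemma exponential_itv (r s t : R) : (0 < r)%R -> (t <= s)%R ->
  exponential_prob r `]t, s]%classic =
  (expR (- r * Num.max t 0) - expR (- r * Num.max s 0))%:E.
Proof.
move=> r0 ts; have [mu muE] := exponential_probability r0.
have : mu `]t, +oo[%classic = mu `]t, s]%classic + mu `]s, +oo[%classic.
  rewrite -measureU//.
    by rewrite -itv_bndbnd_setU// bnd_simp.
  rewrite predeqE => x; split => //= -[]; rewrite !in_itv/= andbT.
  by move=> /andP[_ xs]; rewrite ltNge xs.
rewrite !muE !exponential_tail// EFinB => ->.
by rewrite addeK.
Qed.

Lemma burke_section_empty (s t u x y : R) : (t <= s -> u <= t ->
  ~ (s < u + Num.max (x - y) 0 /\ t < u + Num.max (y - x) 0))%R.
Proof.
by case: (leP (x - y)%R 0%R) => h1; case: (leP (y - x)%R 0%R) => h2 h3 h4 [h5 h6]; lra.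
Qed.

Lemma burke_section_ray (s t u x y : R) : (t <= s -> u <= s -> t < u ->
  (s < u + Num.max (x - y) 0 /\ t < u + Num.max (y - x) 0) <-> y + s - u < x)%R.
Proof.
move=> h3 h4 h5; split.
  by case: (leP (x - y)%R 0%R) => h1; case: (leP (y - x)%R 0%R) => h2 [h6 h7]; lra.
move=> h6.
by case: (leP (x - y)%R 0%R) => h1; case: (leP (y - x)%R 0%R) => h2; split; lra.
Qed.

(** The triple is (weight, (vertical increment, horizontal increment)); the event
    says that the outgoing horizontal increment exceeds [s] and the outgoing vertical
    one exceeds [t]. *)
Definition burke_event (s t : R) :
    set (measurableTypeR R * (measurableTypeR R * measurableTypeR R)) :=
  [set q | (s < q.1 + Num.max (q.2.2 - q.2.1) 0)%R /\
           (t < q.1 + Num.max (q.2.1 - q.2.2) 0)%R].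

Lemma measurable_burke_event s t : measurable (burke_event s t).
Proof.
pose T3 := (measurableTypeR R * (measurableTypeR R * measurableTypeR R))%type.
have m1 : measurable_fun setT (fun q : T3 => q.1 : R) by exact: measurable_fst.
have m2 : measurable_fun setT (fun q : T3 => q.2.1 : R).
  by apply: measurableT_comp; [exact: measurable_fst|exact: measurable_snd].
have m3 : measurable_fun setT (fun q : T3 => q.2.2 : R).
  by apply: measurableT_comp; [exact: measurable_snd|exact: measurable_snd].
have mI : measurable_fun setT (fun q : T3 => q.1 + Num.max (q.2.2 - q.2.1) 0 : R)%R.
  by apply: measurable_funD => //; apply: measurable_maxr => //; exact: measurable_funB.
have mJ : measurable_fun setT (fun q : T3 => q.1 + Num.max (q.2.1 - q.2.2) 0 : R)%R.
  by apply: measurable_funD => //; apply: measurable_maxr => //; exact: measurable_funB.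
rewrite (_ : burke_event s t =
  (fun q : T3 => q.1 + Num.max (q.2.2 - q.2.1) 0)%R @^-1` `]s, +oo[%classic `&`
  (fun q : T3 => q.1 + Num.max (q.2.1 - q.2.2) 0)%R @^-1` `]t, +oo[%classic).
  rewrite -[X in measurable (X `&` _)]setTI -[X in measurable (_ `&` X)]setTI.
  by apply: measurableI; [exact: mI|exact: mJ].
by rewrite predeqE => q; split => -[]; rewrite /= !in_itv/= !andbT.
Qed.

(** For [t <= s], integrate over the weight [u].  If [u > s] the event is certain,
    if [u <= t] it is impossible, and in between it says that the horizontal increment
    exceeds the vertical one by [s - u], which has probability rb * exp (- ra (s - u)).
    All integrals that appear are total masses or tails of exponential laws, since
    [ra + rb = 1]. *)
Lemma burke_tail (ra rb s t : R)
    (mc mb ma : probability (measurableTypeR R) R) :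
  (0 < ra)%R -> (0 < rb)%R -> (ra + rb = 1)%R -> (t <= s)%R ->
  (forall A, measurable A -> ma A = exponential_prob ra A) ->
  (forall A, measurable A -> mb A = exponential_prob rb A) ->
  (forall A, measurable A -> mc A = exponential_prob 1 A) ->
  (mc \x (mb \x ma)%E)%E (burke_event s t) =
  (expR (- ra * Num.max s 0) * expR (- rb * Num.max t 0))%:E.
Proof.
move=> ra0 rb0 rab ts maE mbE mcE.
have mexp c : measurable_fun setT (fun x : measurableTypeR R => expR (c * x)%R : R).
  by apply: measurableT_comp => //; exact: mulrl_measurable.
pose phi (u : R) : R := (\1_`]s, +oo[ u + \1_`]t, s] u * (rb * expR (ra * (u - s))))%R.
have secE u : (mb \x ma)%E (xsection (burke_event s t) u) = (phi u)%:E.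
  rewrite /phi !indicE !mem_setE !in_itv/= andbT.
  have [us|su] := ltP s u.
    rewrite andbF mul0r addr0 -(@probability_setT _ _ _ (mb \x ma)%E).
    congr (_ _); rewrite predeqE => -[y x]; split => // _.
    rewrite /xsection/= inE /burke_event/=; split.
      by rewrite (lt_le_trans us)// lerDl le_max lexx orbT.
    by rewrite (le_lt_trans ts)// (lt_le_trans us)// lerDl le_max lexx orbT.
  have [tu|ut] := ltP t u; last first.
    rewrite mul0r addr0 (_ : xsection _ _ = set0) ?measure0//.
    rewrite predeqE => -[y x]; split => //.
    by rewrite /xsection/= inE /burke_event/=; exact: burke_section_empty.
  rewrite mul1r add0r /product_measure1/=.
  transitivity (\int[mb]_y (expR (- ra * Num.max (y + s - u) 0))%:E).
    apply: eq_integral => y _; rewrite -exponential_tail// -maE//.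
    congr (_ _); rewrite predeqE => x; rewrite /xsection/= in_itv/= andbT inE.
    apply: iff_trans (burke_section_ray x y ts su tu).
    by split => [/set_mem //|h]; exact: mem_set.
  rewrite (integral_exponential rb0)//; last first.
    apply/measurable_EFinP.
    apply: (@measurableT_comp _ _ _ _ _ _ (fun x => expR (- ra * x)%R : R)) => //.
    exact: mexp.
    apply: measurable_maxr => //.
    by under eq_fun do rewrite -addrA; exact: measurable_funD.
  transitivity (\int[lebesgue_measure]_x
      ((rb * expR (ra * (u - s)))%:E * (exponential_pdf 1 x)%:E)).
    apply: eq_integral => y _; rewrite -!EFinM; congr EFin.
    have [y0|y0] := ltP y 0%R; first by rewrite !lt0_exponential_pdf// !mul0r mulr0.
    rewrite !exponential_pdfE// max_l; last by lra.
    rewrite mul1r -mulrA -!expRD -mulrA -expRD; congr (_ * expR _)%R; nra.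
  rewrite ge0_integralZl ?integral_exponential_pdf ?mule1//.
  - by apply/measurable_EFinP; exact: measurable_exponential_pdf.
  - by move=> x _; rewrite lee_fin exponential_pdf_ge0.
  - by rewrite lee_fin mulr_ge0 ?ltW// expR_gt0.
transitivity (\int[mc]_u (phi u)%:E).
  by apply: eq_integral => u _; exact: secE.
have phi1 u : (phi u)%:E = (\1_`]s, +oo[ u)%:E +
    (\1_`]t, s] u * (rb * expR (ra * (u - s))))%:E by [].
have mexp' : measurable_fun setT
    (fun u : measurableTypeR R => rb * expR (ra * (u - s)) : R)%R.
  apply: measurable_funM => //; apply: measurableT_comp => //.
  by apply: measurable_funM => //; exact: measurable_funB.
under eq_integral do rewrite phi1.
rewrite ge0_integralD//; last 3 first.
- by apply/measurable_EFinP; exact: measurable_indic.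
- move=> u _; rewrite lee_fin indicE mulr_ge0//.
  by rewrite mulr_ge0 ?expR_ge0// ltW.
- by apply/measurable_EFinP; apply: measurable_funM => //; exact: measurable_indic.
rewrite integral_indic// setIT (integral_exponential ltr01)//; last 2 first.
- by apply/measurable_EFinP; apply: measurable_funM => //; exact: measurable_indic.
- move=> u; rewrite lee_fin indicE mulr_ge0//.
  by rewrite mulr_ge0 ?expR_ge0// ltW.
transitivity (mc `]s, +oo[%classic + \int[lebesgue_measure]_u
    ((expR (- ra * s))%:E * ((exponential_pdf rb u)%:E * (\1_`]t, s] u)%:E))).
  congr (_ + _); apply: eq_integral => u _; rewrite -!EFinM; congr EFin.
  have [u0|u0] := ltP u 0%R; first by rewrite !lt0_exponential_pdf// !mul0r mulr0.
  rewrite !exponential_pdfE//.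
  have expE : (expR (-1 * u) * expR (ra * (u - s)) = expR (- ra * s) * expR (- rb * u))%R.
    rewrite -!expRD; congr expR; have -> : ra = (1 - rb)%R by lra.
    by ring.
  transitivity (rb * \1_`]t, s] u * (expR (-1 * u) * expR (ra * (u - s))))%R.
    by ring.
  by rewrite expE; ring.
rewrite ge0_integralZl//; last 2 first.
- apply: emeasurable_funM.
    by apply/measurable_EFinP; exact: measurable_exponential_pdf.
  by apply/measurable_EFinP; exact: measurable_indic.
- by move=> u _; rewrite mule_ge0 ?lee_fin// exponential_pdf_ge0// ltW.
have -> : \int[lebesgue_measure]_u ((exponential_pdf rb u)%:E * (\1_`]t, s] u)%:E) =
    exponential_prob rb `]t, s]%classic.
  by rewrite /exponential_prob [RHS]integral_mkcond epatch_indic.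
rewrite mcE// exponential_tail// exponential_itv// -EFinM -EFinD; congr EFin.
have [s0|s0] := leP 0%R s.
  rewrite mulN1r mulrBr -!expRD (_ : - ra * s + - rb * s = - s)%R.
    by rewrite addrC subrK.
  by rewrite -mulrDl -opprD rab mulN1r.
rewrite max_r; last by rewrite (le_trans ts)// ltW.
by rewrite !mulr0 expR0 subrr mulr0 addr0 mulr1.
Qed.

End real_laws.

(** * Independent exponential families *)

Section independent_exponentials.
Context d (T : measurableType d) (R : realType).
Notation M := (measurableTypeR R).
Local Open Scope ereal_scope.

(** The constant [c] allows for the restriction of a probability to an event
    independent of both variables. *)
Lemma joint_law_product d1 d2 (T1 : measurableType d1) (T2 : measurableType d2)
    (Q : {measure set T -> \bar R}) (Y1 : T -> T1) (Y2 : T -> T2)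
    (m1 : probability T1 R) (m2 : probability T2 R) (c : R) :
  measurable_fun setT Y1 -> measurable_fun setT Y2 -> (0 <= c)%R ->
  (forall A B, measurable A -> measurable B ->
    Q (Y1 @^-1` A `&` Y2 @^-1` B) = c%:E * (m1 A * m2 B)) ->
  forall C, measurable C ->
    Q ((fun t => (Y1 t, Y2 t)) @^-1` C) = c%:E * (m1 \x m2) C.
Proof.
move=> mY1 mY2; rewrite le_eqVlt => /predU1P[<-|c0] QE C mC.
  have mY : measurable_fun setT (fun t => (Y1 t, Y2 t)) by exact: measurable_fun_pair.
  rewrite mul0e; apply/eqP; rewrite eq_le measure_ge0 andbT.
  have := QE _ _ measurableT measurableT; rewrite mul0e !preimage_setT setIT => <-.
  by rewrite le_measure ?inE// -[X in measurable X]setTI; exact: mY.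
have ic0 : (0 <= c^-1)%R by rewrite invr_ge0 ltW.
pose c' : {nonneg R} := NngNum ic0.
have mY : measurable_fun setT (fun t => (Y1 t, Y2 t)) by exact: measurable_fun_pair.
rewrite (@product_measure_unique _ _ _ _ _ m1 m2
  (mscale c' (pushforward Q (fun t => (Y1 t, Y2 t)))))//.
  by rewrite /mscale/= /pushforward muleA -EFinM divff ?mul1e// gt_eqF.
move=> A B mA mB; rewrite /mscale/= /pushforward.
transitivity ((c^-1)%:E * Q (Y1 @^-1` A `&` Y2 @^-1` B)); first by [].
by rewrite QE// muleA -EFinM mulVf ?mul1e// gt_eqF.
Qed.

Lemma joint_law_tails (Q : {measure set T -> \bar R}) (Y1 Y2 : T -> M)
    (m1 m2 : probability M R) (c : R) :
  measurable_fun setT Y1 -> measurable_fun setT Y2 -> (0 <= c)%R ->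
  Q setT < +oo ->
  (forall s t : R, Q (Y1 @^-1` `]s, +oo[%classic `&` Y2 @^-1` `]t, +oo[%classic) =
     c%:E * (m1 `]s, +oo[%classic * m2 `]t, +oo[%classic)) ->
  forall A B, measurable A -> measurable B ->
    Q (Y1 @^-1` A `&` Y2 @^-1` B) = c%:E * (m1 A * m2 B).
Proof.
move=> mY1 mY2 c0 Qfin tails A B mA mB.
have mpre (Y : T -> M) U : measurable_fun setT Y -> measurable U -> measurable (Y @^-1` U).
  by move=> mY mU; rewrite -[X in measurable X]setTI; exact: mY.
have restr_fin V (mV : measurable V) : Q (setT `&` V) < +oo.
  by rewrite setTI (le_lt_trans _ Qfin)// le_measure// inE.
have step1 t U : measurable U -> Q (Y1 @^-1` U `&` Y2 @^-1` `]t, +oo[%classic) =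
     c%:E * (m1 U * m2 `]t, +oo[%classic).
  have mt := mpre _ _ mY2 (measurable_itv `]t, +oo[).
  have k0 : (0 <= c * fine (m2 `]t, +oo[%classic))%R by rewrite mulr_ge0 ?fine_ge0.
  have kE V : (c * fine (m2 `]t, +oo[%classic))%:E * m1 V =
      c%:E * (m1 V * m2 `]t, +oo[%classic).
    by rewrite EFinM fineK ?fin_num_measure// [X in _ = _ * X]muleC muleA.
  move=> mU; rewrite -kE.
  apply: (@measure_unique_itvoy _ (pushforward (mrestr Q mt) Y1) (mscale (NngNum k0) m1)) => //.
    exact: restr_fin.
  by move=> x; exact: etrans (tails x t) (esym (kE _)).
have mA' := mpre _ _ mY1 mA.
have k0 : (0 <= c * fine (m1 A))%R by rewrite mulr_ge0 ?fine_ge0.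
have kE V : (c * fine (m1 A))%:E * m2 V = c%:E * (m1 A * m2 V).
  by rewrite EFinM fineK ?fin_num_measure// muleA.
rewrite -kE setIC.
apply: (@measure_unique_itvoy _ (pushforward (mrestr Q mA') Y2) (mscale (NngNum k0) m2)) => //.
  exact: restr_fin.
move=> x; transitivity (c%:E * (m1 A * m2 `]x, +oo[%classic)); last exact/esym/kE.
by rewrite -[RHS]step1// [X in _ = Q X]setIC.
Qed.

Variable I : choiceType.

Definition joint_event (X : I -> T -> R) (A : I -> set R) (s : seq I) : set T :=
  \big[setI/setT]_(i <- s) (X i @^-1` A i).

(** Mutual independence and the marginal laws in a single product formula over
    finite lists of indices in [D].  [Q] is a bare measure because it varies along
    changes of measure; that its total mass is 1 is the case of the empty list. *)
Record independent_exponentials (Q : {measure set T -> \bar R})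
    (X : I -> T -> R) (rate : I -> R) (D : pred I) : Prop := {
  indep_measurable : forall i, D i -> measurable_fun setT (X i);
  indep_rate_gt0 : forall i, D i -> (0 < rate i)%R;
  indep_law : forall s A, uniq s -> all D s -> (forall i, measurable (A i)) ->
    Q (joint_event X A s) = \prod_(i <- s) exponential_prob (rate i) (A i) }.

Lemma joint_eventP X A s t :
  joint_event X A s t <-> (forall i, i \in s -> A i (X i t)).
Proof.
rewrite /joint_event; elim: s => [|a s IH]; first by rewrite big_nil.
rewrite big_cons; split.
  by move=> [ha /IH hs] i; rewrite inE => /predU1P[->//|/hs].
move=> h; split; first by apply: h; rewrite inE eqxx.
by apply/IH => i si; apply: h; rewrite inE si orbT.
Qed.

Lemma exponential_prob_setT (r : R) : (0 < r)%R -> exponential_prob r setT = 1.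
Proof. by move=> /exponential_probability[mu <-]; exact: probability_setT. Qed.

Lemma measurable_joint_event X A s : (forall i, i \in s -> measurable_fun setT (X i)) ->
  (forall i, measurable (A i)) -> measurable (joint_event X A s).
Proof.
move=> mX mA; rewrite /joint_event; elim: s mX => [|a s IH] mX.
  by rewrite big_nil.
rewrite big_cons; apply: measurableI.
  rewrite -[X in measurable X]setTI; apply: mX => //.
  by rewrite inE eqxx.
by apply: IH => i si; apply: mX; rewrite inE si orbT.
Qed.

(** Inserting the indices of [l] with trivial constraints: it suffices to prove
    the product formula for lists that begin with [l]. *)
Lemma law_extend (Q : {measure set T -> \bar R}) X rate (D : pred I) (l s : seq I) A :
  (forall i, D i -> (0 < rate i)%R) -> uniq l -> all D l -> uniq s -> all D s ->
  (forall i, measurable (A i)) ->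
  (forall B, (forall i, measurable (B i)) ->
    Q (joint_event X B (l ++ [seq i <- s | i \notin l])) =
    \prod_(i <- l ++ [seq i <- s | i \notin l]) exponential_prob (rate i) (B i)) ->
  Q (joint_event X A s) = \prod_(i <- s) exponential_prob (rate i) (A i).
Proof.
move=> r0 ul Dl us Ds mA /(_ (fun i => if i \in s then A i else setT)) QE.
set s' := l ++ _ in QE.
have us' : uniq s'.
  rewrite cat_uniq ul filter_uniq// andbT/=; apply/hasPn => i.
  by rewrite mem_filter => /andP[].
have ss' i : i \in s -> i \in s'.
  by rewrite mem_cat mem_filter; case: (i \in l).
have Ds' i : i \in s' -> D i.
  rewrite mem_cat mem_filter => /orP[|/andP[_]]; first exact: (allP Dl).
  exact: (allP Ds).
transitivity (Q (joint_event X (fun i => if i \in s then A i else setT) s')).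
  congr (Q _); rewrite predeqE => t; split => /joint_eventP h; apply/joint_eventP => i.
    by case: ifPn => // si _; exact: h.
  by move=> si; have := h i (ss' _ si); rewrite si.
rewrite QE; last by move=> i; case: ifPn.
transitivity (\prod_(i <- s' | i \in s) exponential_prob (rate i) (A i)).
  rewrite [RHS]big_mkcond/= big_seq [RHS]big_seq; apply: eq_bigr => i /Ds' Di.
  by case: ifPn => // _; rewrite exponential_prob_setT// r0.
rewrite -big_filter; apply: perm_big; apply: uniq_perm; rewrite ?filter_uniq//.
by move=> i; rewrite mem_filter; case: (boolP (i \in s)) => // /ss' ->.
Qed.

Implicit Types (Q : {measure set T -> \bar R}) (X : I -> T -> R)
  (rate : I -> R) (D : pred I) (A : I -> set R).

Lemma indep_setT Q X rate D : independent_exponentials Q X rate D -> Q setT = 1.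
Proof.
move=> iX; have := indep_law iX (s := [::]) (A := fun=> setT).
by rewrite /joint_event !big_nil; exact.
Qed.

Lemma indep_ext Q X X' rate rate' D D' : independent_exponentials Q X rate D ->
  (forall i, D' i -> [/\ D i, X' i = X i & rate' i = rate i]) ->
  independent_exponentials Q X' rate' D'.
Proof.
move=> iX DD'; split.
- by move=> i /DD'[Di -> _]; exact: (indep_measurable iX).
- by move=> i /DD'[Di _ ->]; exact: (indep_rate_gt0 iX).
move=> s A us /allP Ds mA.
transitivity (Q (joint_event X A s)).
  by congr (Q _); apply: eq_big_seq => i /Ds /DD'[_ ->].
have Ds' : all D s by apply/allP => i /Ds /DD'[].
rewrite (indep_law iX us Ds' mA).
by apply: eq_big_seq => i /Ds /DD'[_ _ ->].
Qed.

Lemma indep_head Q X rate D a s A B : independent_exponentials Q X rate D ->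
  uniq (a :: s) -> all D (a :: s) -> measurable B -> (forall i, measurable (A i)) ->
  Q (X a @^-1` B `&` joint_event X A s) =
  exponential_prob (rate a) B * Q (joint_event X A s).
Proof.
move=> iX us Ds mB mA; have /= /andP[as_ us'] := us; have /= /andP[Da Ds'] := Ds.
pose A' i := if i == a then B else A i.
have AE i : i \in s -> A' i = A i.
  by rewrite /A'; case: eqP => // -> /(negP as_).
have JE : joint_event X A s = joint_event X A' s.
  by apply: eq_big_seq => i si; rewrite AE.
have mA' i : measurable (A' i) by rewrite /A'; case: ifP.
have A'a : A' a = B by rewrite /A' eqxx.
have := indep_law iX us Ds mA'.
by rewrite JE (indep_law iX us' Ds' mA') /joint_event !big_cons A'a.
Qed.

Lemma fin_joint_event Q X rate D s A : independent_exponentials Q X rate D ->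
  all D s -> (forall i, measurable (A i)) ->
  exists2 c : R, (0 <= c)%R & Q (joint_event X A s) = c%:E.
Proof.
move=> iX /allP Ds mA.
have mJ : measurable (joint_event X A s).
  by apply: measurable_joint_event => // i /Ds; exact: (indep_measurable iX).
exists (fine (Q (joint_event X A s))); first by rewrite fine_ge0.
rewrite fineK// ge0_fin_numE// (@le_lt_trans _ _ 1) ?ltry//.
by rewrite -(indep_setT iX) le_measure// inE.
Qed.

(** The effect of crossing a cell with weight [c], incoming horizontal increment
    [a] and incoming vertical increment [b]: the outgoing increments replace the
    incoming ones. *)
Definition burke_update X a b c (i : I) : T -> R :=
  if i == a then fun t => (X c t + Num.max (X a t - X b t) 0)%R
  else if i == b then fun t => (X c t + Num.max (X b t - X a t) 0)%R
  else X i.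

Definition triple X a b c : T -> M * (M * M) :=
  fun t => (X c t, (X b t, X a t)).

Lemma burke_triple_law Q X rate D a b c s A (mc ma mb : probability M R) (k : R):
  independent_exponentials Q X rate D ->
  uniq (c :: b :: a :: s) -> all D (c :: b :: a :: s) ->
  (forall i, measurable (A i)) -> (0 <= k)%R -> Q (joint_event X A s) = k%:E ->
  (forall U, ma U = exponential_prob (rate a) U) ->
  (forall U, mb U = exponential_prob (rate b) U) ->
  (forall U, mc U = exponential_prob (rate c) U) ->
  forall C, measurable C ->
  Q (triple X a b c @^-1` C `&` joint_event X A s) =
  k%:E * (mc \x (mb \x ma)%E)%E C.
Proof.
move=> iX us Ds mA k0 kE maE mbE mcE.
have [Dc [Db [Da Ds']]] : D c /\ D b /\ D a /\ all D s.
  by move: Ds => /= /and4P[].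
have [cb ca cs [ba [bs [as_ us']]]] : [/\ c != b, c != a, c \notin s &
    b != a /\ b \notin s /\ a \notin s /\ uniq s].
  move: us; rewrite /= !inE !negb_or.
  by case/and4P => /and3P[cb ca cs] /andP[ba bs] as_ us'; split.
have neq (u v : I) (l : seq I) : u \in l -> v \notin l -> u <> v.
  by move=> ul /negP vl uv; rewrite -uv in vl.
have acs : a \notin c :: s by rewrite inE negb_or eq_sym ca.
have mXa := indep_measurable iX Da.
have mXb := indep_measurable iX Db.
have mXc := indep_measurable iX Dc.
have mpre (Y : T -> M) U : measurable_fun setT Y -> measurable U -> measurable (Y @^-1` U).
  by move=> mY mU; rewrite -[X in measurable X]setTI; exact: mY.
have mJ : measurable (joint_event X A s).
  by apply: measurable_joint_event => // i /(allP Ds'); exact: (indep_measurable iX).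
pose Yba : T -> M * M := fun t => (X b t, X a t).
have mba : measurable_fun setT Yba.
  by apply: (@measurable_fun_pair _ _ _ _ M M).
move=> C mC.
transitivity (mrestr Q mJ ((fun t => ((X c t : M), Yba t)) @^-1` C)); first by [].
apply: (@joint_law_product _ _ _ _ (mrestr Q mJ) (X c : T -> M)
  Yba mc (mb \x ma)%E) => //.
move=> U V mU mV.
have mcJ : measurable (X c @^-1` U `&` joint_event X A s).
  by apply: measurableI => //; exact: mpre.
have cJE : Q (X c @^-1` U `&` joint_event X A s) = (fine (mc U) * k)%:E.
  rewrite (indep_head iX)//.
  - by rewrite -mcE kE EFinM fineK// fin_num_measure.
  - by rewrite /= cs.
  - by rewrite /= Dc.
transitivity (mrestr Q mcJ (Yba @^-1` V)).
  by rewrite /mrestr setIA [in LHS](setIC (X c @^-1` _)).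
rewrite (@joint_law_product _ _ _ _ (mrestr Q mcJ) (X b : T -> M) (X a : T -> M) mb ma
  (fine (mc U) * k))//.
- by rewrite EFinM fineK ?fin_num_measure// [mc U * _]muleC muleA.
- by rewrite mulr_ge0// fine_ge0.
move=> V1 V2 mV1 mV2; rewrite /mrestr.
have JE : X c @^-1` U `&` joint_event X A s =
    joint_event X (fun i => if i == c then U else A i) (c :: s).
  rewrite /joint_event big_cons eqxx; congr (_ `&` _); apply: eq_big_seq => i si.
  by case: eqP (neq _ c s si cs).
have mA' i : measurable (if i == c then U else A i).
  by case: ifP => _; [exact: mU|exact: mA].
transitivity (Q (X b @^-1` V1 `&` (joint_event X
  (fun i => if i == a then V2 else if i == c then U else A i) (a :: c :: s)))).
  congr (Q _); rewrite -setIA; congr (_ `&` _); rewrite JE.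
  rewrite [in RHS]/joint_event big_cons eqxx; congr (_ `&` _).
  by apply: eq_big_seq => i si; rewrite (introF eqP (neq _ a (c :: s) si acs)).
rewrite (indep_head iX)//.
- rewrite -mbE.
  transitivity (mb V1 * Q (X a @^-1` V2 `&` (X c @^-1` U `&` joint_event X A s))).
    congr (_ * Q _); rewrite JE [in LHS]/joint_event big_cons eqxx; congr (_ `&` _).
    by apply: eq_big_seq => i si; rewrite (introF eqP (neq _ a (c :: s) si acs)).
  rewrite JE (indep_head iX)//.
  + by rewrite -JE cJE -maE [RHS]muleC muleA.
  + by rewrite /= acs cs.
  + by rewrite /= Da Dc.
- by rewrite /= acs cs us' !inE !negb_or ba (eq_sym b) cb bs.
- by rewrite /= Da Db Dc.
- by move=> i; case: ifP => _; [exact: mV2|exact: mA'].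
Qed.

(** Burke's theorem for one cell.  The weight is consumed, so its index leaves
    the family; the rest of the family is carried along by conditioning on an event
    that concerns the other indices. *)
Lemma burke_step Q X rate D a b c : independent_exponentials Q X rate D ->
  [/\ D a, D b & D c] -> uniq [:: a; b; c] ->
  (rate a + rate b = 1)%R -> (rate c = 1)%R ->
  independent_exponentials Q (burke_update X a b c) rate (predI D (predC1 c)).
Proof.
move=> iX [Da Db Dc] uabc rab rc.
have mpre (Y : T -> M) U : measurable_fun setT Y -> measurable U -> measurable (Y @^-1` U).
  by move=> mY mU; rewrite -[X in measurable X]setTI; exact: mY.
have mXa := indep_measurable iX Da.
have mXb := indep_measurable iX Db.
have mXc := indep_measurable iX Dc.
have [ab [ac bc]] : a != b /\ a != c /\ b != c.
  by move: uabc; rewrite /= !inE negb_or andbT => /andP[/andP[]].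
have mX' i : (predI D (predC1 c)) i -> measurable_fun setT (burke_update X a b c i).
  move=> /andP[Di _]; rewrite /burke_update; case: ifP => _.
    by apply: measurable_funD => //; apply: measurable_maxr => //; exact: measurable_funB.
  case: ifP => _.
    by apply: measurable_funD => //; apply: measurable_maxr => //; exact: measurable_funB.
  exact: (indep_measurable iX).
split => //.
  by move=> i /andP[Di _]; exact: (indep_rate_gt0 iX).
move=> s A us Ds mA.
have r0 i : (predI D (predC1 c)) i -> (0 < rate i)%R.
  by move=> /andP[Di _]; exact: (indep_rate_gt0 iX).
apply: (@law_extend _ _ _ (predI D (predC1 c)) [:: a; b]) => //=.
- by rewrite inE ab.
- by rewrite Da Db ac bc.
move=> {A mA}A mA; set s' := [seq i <- s | _].
have us' : uniq s' by rewrite filter_uniq.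
have Ds' : all D s' by apply/allP => i; rewrite mem_filter => /andP[_ /(allP Ds)/andP[]].
have as' : a \notin s' by rewrite mem_filter !inE eqxx.
have bs' : b \notin s' by rewrite mem_filter !inE eqxx orbT.
have cs' : c \notin s'.
  by rewrite mem_filter !inE; apply/negP => /andP[_ /(allP Ds)]; rewrite /= eqxx andbF.
rewrite /joint_event !big_cons.
have JE : \big[setI/setT]_(i <- s') (burke_update X a b c i @^-1` A i) = joint_event X A s'.
  apply: eq_big_seq => i si; rewrite /burke_update.
  by case: eqP => [ia|_]; [rewrite -ia si in as'|case: eqP => [ib|//]; rewrite -ib si in bs'].
rewrite JE -(indep_law iX us' Ds' mA).
have [k k0 kE] := fin_joint_event iX Ds' mA.
have [ma maE] := exponential_probability (indep_rate_gt0 iX Da).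
have [mb mbE] := exponential_probability (indep_rate_gt0 iX Db).
have [mc mcE] := exponential_probability (indep_rate_gt0 iX Dc).
have mJ : measurable (joint_event X A s').
  by apply: measurable_joint_event => // i /(allP Ds'); exact: (indep_measurable iX).
rewrite kE muleA muleC -maE -mbE setIA.
have mX'a : measurable_fun setT (burke_update X a b c a) by apply: mX'; rewrite /= Da.
have mX'b : measurable_fun setT (burke_update X a b c b) by apply: mX'; rewrite /= Db.
apply: (@joint_law_tails (mrestr Q mJ) _ _ ma mb) => //; [|..|exact: mA|exact: mA].
  apply: (@le_lt_trans _ _ (Q (joint_event X A s'))); last by rewrite kE ltry.
  by apply: le_measure; rewrite ?inE; [exact: measurableI|exact: mJ|exact: subIsetr].
move=> x y; rewrite /burke_update !eqxx ifN 1?eq_sym// /mrestr.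
rewrite [X in _ = _ * X](_ : _ = (expR (- rate a * Num.max x 0) *
  expR (- rate b * Num.max y 0))%:E); last first.
  by rewrite maE mbE !exponential_tail ?(indep_rate_gt0 iX).
have [yx|xy] := leP y x.
  rewrite -(@burke_tail _ (rate a) (rate b) x y mc mb ma)//; last 3 first.
  - exact: (indep_rate_gt0 iX).
  - exact: (indep_rate_gt0 iX).
  - by move=> U _; rewrite mcE rc.
  rewrite -(burke_triple_law iX _ _ mA k0 kE maE mbE mcE)//.
  - congr (Q (_ `&` _)); rewrite predeqE => t; rewrite /burke_event/= !in_itv/= !andbT.
    by split => -[].
  - by rewrite /= !inE !negb_or eq_sym bc eq_sym ac cs' eq_sym ab bs' as'.
  - by rewrite /= Dc Db Da.
  - exact: measurable_burke_event.
rewrite mulrC -(@burke_tail _ (rate b) (rate a) y x mc ma mb)//; last 5 first.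
- exact: (indep_rate_gt0 iX).
- exact: (indep_rate_gt0 iX).
- by rewrite addrC.
- exact: ltW.
- by move=> U _; rewrite mcE rc.
rewrite -(burke_triple_law iX _ _ mA k0 kE mbE maE mcE)//.
- congr (Q (_ `&` _)); rewrite predeqE => t; rewrite /burke_event/= !in_itv/= !andbT.
  by split => -[].
- by rewrite /= !inE !negb_or eq_sym ac eq_sym bc cs' ab bs' as'.
- by rewrite /= Dc Db Da.
- exact: measurable_burke_event.
Qed.

Lemma integral_indep_head Q X rate D a s A (k : R) (f : M -> \bar R) :
  independent_exponentials Q X rate D -> uniq (a :: s) -> all D (a :: s) ->
  (forall i, measurable (A i)) -> (0 <= k)%R -> Q (joint_event X A s) = k%:E ->
  measurable_fun setT f -> (forall x, 0 <= f x) ->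
  \int[Q]_t ((\1_(joint_event X A s) t)%:E * f (X a t)) =
  k%:E * \int[lebesgue_measure]_x ((exponential_pdf (rate a) x)%:E * f x).
Proof.
move=> iX us Ds mA k0 kE mf f0.
have /= /andP[Da Ds'] := Ds.
have mXa : measurable_fun setT (X a : T -> M) := indep_measurable iX Da.
have mJ : measurable (joint_event X A s).
  by apply: measurable_joint_event => // i /(allP Ds'); exact: (indep_measurable iX).
have [||Q1 [Q1E Q1int]] := @density_measure _ _ _ Q (\1_(joint_event X A s)).
- exact: measurable_indic.
- by move=> t; rewrite indicE.
have mfX : measurable_fun setT (f \o X a) by exact: (measurableT_comp mf mXa).
rewrite -Q1int//.
have [mu muE] := exponential_probability (indep_rate_gt0 iX Da).
transitivity (\int[pushforward Q1 (X a : T -> M)]_x f x).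
  by rewrite [RHS]ge0_integral_pushforward// preimage_setT.
rewrite (eq_measure_integral (mscale (NngNum k0) mu)).
  rewrite ge0_integral_mscale//; congr (_ * _).
  by rewrite (integral_exponential (indep_rate_gt0 iX Da) (fun U _ => muE U)).
move=> U mU _; transitivity (Q1 (X a @^-1` U)); first by [].
rewrite Q1E; last first.
  by rewrite -[X in measurable X]setTI; exact: mXa.
rewrite integral_indic//; last by rewrite -[X in measurable X]setTI; exact: mXa.
transitivity (k%:E * mu U); last by [].
by rewrite setIC (indep_head iX)// kE muleC muE.
Qed.

(** The density (r / r_a) exp ((r_a - r) x) of Exp(r) with respect to Exp(r_a)
    changes one marginal and leaves the product structure intact. *)
Lemma tilt_one Q X rate D a (r : R) : independent_exponentials Q X rate D ->
  D a -> (0 < r)%R ->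
  exists Q' : {measure set T -> \bar R},
    independent_exponentials Q' X (fun i => if i == a then r else rate i) D /\
    forall f : T -> \bar R, measurable_fun setT f -> (forall t, 0 <= f t) ->
      \int[Q']_t f t =
      \int[Q]_t ((r / rate a * expR ((rate a - r) * X a t))%:E * f t).
Proof.
move=> iX Da r0.
have ra0 := indep_rate_gt0 iX Da.
have mXa : measurable_fun setT (X a : T -> M) := indep_measurable iX Da.
pose G (x : M) : R := (r / rate a * expR ((rate a - r) * x))%R.
have mG : measurable_fun setT G.
  have mexp c : measurable_fun setT (fun x : M => expR (c * x)%R : R).
    by apply: measurableT_comp => //; exact: mulrl_measurable.
  by apply: measurable_funM => //; exact: mexp.
have G0 x : (0 <= G x)%R by rewrite mulr_ge0 ?expR_ge0// divr_ge0// ltW.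
have [||Q' [Q'E Q'int]] := @density_measure _ _ _ Q (G \o X a).
- exact: (measurableT_comp mG mXa).
- by move=> t; exact: G0.
exists Q'; split => //.
have rate0 i : D i -> (0 < if i == a then r else rate i)%R.
  by move=> Di; case: ifP => // _; exact: (indep_rate_gt0 iX).
split => //; first exact: (indep_measurable iX).
move=> s A us Ds mA.
apply: (@law_extend _ _ _ D [:: a]) => //=; first by rewrite Da.
move=> {A mA}A mA; set s' := [seq i <- s | _].
have us' : uniq (a :: s') by rewrite /= filter_uniq// mem_filter inE eqxx.
have as' : a \notin s' by case/andP: us'.
have Ds' : all D (a :: s').
  by rewrite /= Da; apply/allP => i; rewrite mem_filter => /andP[_ /(allP Ds)].
have [k k0 kE] : exists2 c : R, (0 <= c)%R & Q (joint_event X A s') = c%:E.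
  by apply: (fin_joint_event iX) => //; case/andP: Ds'.
rewrite big_cons eqxx.
have -> : \prod_(j <- s') exponential_prob (if j == a then r else rate j) (A j) = k%:E.
  have usl : uniq s' by case/andP: us'.
  have Dsl : all D s' by case/andP: Ds'.
  rewrite -kE (indep_law iX usl Dsl mA).
  apply: eq_big_seq => i si.
  by have -> : (i == a) = false by apply: contraNF as' => /eqP <-.
have mJ : measurable (joint_event X A s').
  apply: measurable_joint_event => // i si; apply: (indep_measurable iX).
  by move: Ds' => /= /andP[_ /allP]; exact.
have mA' : measurable (A a : set M) by exact: mA.
have mXA : measurable (X a @^-1` A a) by rewrite -[X in measurable X]setTI; exact: mXa.
rewrite /joint_event big_cons -/(joint_event X A s') Q'E; last exact: measurableI.
transitivity (\int[Q]_t ((\1_(joint_event X A s') t)%:E *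
  ((\1_(A a) (X a t))%:E * (G (X a t))%:E))).
  rewrite integral_mkcond epatch_indic; apply: eq_integral => t _.
  rewrite /= muleC muleA; congr (_ * _); rewrite -EFinM; congr EFin.
  by rewrite !indicE in_setI /= mulrC -natrM mulnb.
rewrite (@integral_indep_head _ _ _ _ _ _ _ k
  (fun x => (\1_(A a) x)%:E * (G x)%:E) iX)//; last 2 first.
- by apply: emeasurable_funM; apply/measurable_EFinP.
- by move=> x; rewrite mule_ge0 ?lee_fin// indicE.
rewrite muleC; congr (_ * _).
rewrite /exponential_prob [RHS]integral_mkcond epatch_indic.
apply: eq_integral => x _; rewrite /= muleCA muleC; congr (_ * _).
rewrite -EFinM; congr EFin.
have [x0|x0] := ltP x 0%R; first by rewrite !lt0_exponential_pdf// mul0r.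
rewrite !exponential_pdfE// /G.
transitivity (rate a * (r / rate a) * (expR (- rate a * x) * expR ((rate a - r) * x)))%R.
  by ring.
rewrite -expRD mulrCA divff ?gt_eqF// mulr1; congr (_ * expR _)%R; ring.
Qed.

(** The density that changes the rates of the variables in [l] from [rate] to
    [rate']. *)
Definition tilt X rate rate' (l : seq I) (t : T) : R :=
  (\prod_(i <- l) (rate' i / rate i * expR ((rate i - rate' i) * X i t)))%R.

Lemma measurable_tilt X rate rate' l :
  (forall i, i \in l -> measurable_fun setT (X i)) ->
  measurable_fun setT (tilt X rate rate' l).
Proof.
elim: l => [|a l IH] mX.
  have -> : tilt X rate rate' [::] = cst 1%R by apply/funext => t; rewrite /tilt big_nil.
  exact: measurable_cst.
have mXa : measurable_fun setT (X a) by apply: mX; exact: mem_head.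
have -> : tilt X rate rate' (a :: l) = (fun t => rate' a / rate a *
    expR ((rate a - rate' a) * X a t) * tilt X rate rate' l t)%R.
  by apply/funext => t; rewrite /tilt big_cons.
apply: measurable_funM; last by apply: IH => i il; apply: mX; rewrite inE il orbT.
apply: measurable_funM => //; apply: measurableT_comp => //.
exact: measurable_funM.
Qed.

Lemma tilt_ge0 X rate rate' l t : (forall i, i \in l -> 0 < rate i)%R ->
  (forall i, i \in l -> 0 < rate' i)%R -> (0 <= tilt X rate rate' l t)%R.
Proof.
move=> r0 r'0; rewrite /tilt big_seq; apply: prodr_ge0 => i il.
by rewrite mulr_ge0 ?expR_ge0// divr_ge0// ltW// ?r0 ?r'0.
Qed.

Lemma tilt_exponentials Q X rate rate' D l : independent_exponentials Q X rate D ->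
  uniq l -> all D l -> (forall i, i \in l -> (0 < rate' i)%R) ->
  exists Q' : {measure set T -> \bar R},
    independent_exponentials Q' X (fun i => if i \in l then rate' i else rate i) D /\
    forall f : T -> \bar R, measurable_fun setT f -> (forall t, 0 <= f t) ->
      \int[Q']_t f t = \int[Q]_t ((tilt X rate rate' l t)%:E * f t).
Proof.
elim: l Q rate => [|a l IH] Q rate iX.
  move=> _ _ _; exists Q; split; first exact: iX.
  by move=> f _ _; apply: eq_integral => t _; rewrite /tilt big_nil mul1e.
rewrite [uniq _]/= [all _ _]/= => /andP[al ul] /andP[Da Dl] r0.
have ra0 := r0 a (mem_head _ _).
have r'0 i : i \in l -> (0 < rate' i)%R by move=> il; apply: r0; rewrite inE il orbT.
have [Q1 [iX1 Q1int]] := tilt_one iX Da ra0.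
have [Q2 [iX2 Q2int]] := IH Q1 _ iX1 ul Dl r'0.
exists Q2; split.
  apply: (indep_ext iX2) => i Di; split => //; rewrite inE.
  by case: eqP => [->|//] /=; rewrite (negbTE al).
have tiltE t : tilt X (fun i => if i == a then rate' a else rate i) rate' l t =
    tilt X rate rate' l t.
  apply: eq_big_seq => i il; case: eqP => // ia; by rewrite -ia il in al.
move=> f mf f0; rewrite Q2int//.
under eq_integral do rewrite tiltE.
rewrite Q1int//; last 2 first.
- apply: emeasurable_funM => //; apply/measurable_EFinP; apply: measurable_tilt => i il.
  by apply: (indep_measurable iX); exact: (allP Dl).
- move=> t; rewrite mule_ge0// lee_fin; apply: tilt_ge0 => // i il.
  by apply: (indep_rate_gt0 iX); exact: (allP Dl).
by apply: eq_integral => t _; rewrite /tilt big_cons EFinM muleA.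
Qed.

Lemma indep_scale Q X rate D (c : I -> R) : independent_exponentials Q X rate D ->
  (forall i, D i -> 0 < c i)%R ->
  independent_exponentials Q (fun i t => c i * X i t)%R (fun i => rate i / c i)%R D.
Proof.
move=> iX c0; split.
- by move=> i Di; apply: measurable_funM => //; exact: (indep_measurable iX).
- by move=> i Di; rewrite divr_gt0 ?c0// (indep_rate_gt0 iX).
move=> s A us Ds mA.
have mscale_c r : measurable_fun setT (fun x : M => r * x : M)%R by exact: mulrl_measurable.
transitivity (Q (joint_event X (fun i => [set x | A i (c i * x)%R]) s)).
  by congr (Q _).
have mA' i : measurable [set x | A i (c i * x)%R].
  by rewrite -[X in measurable X]setTI; exact: (mscale_c (c i) measurableT (A i) (mA i)).
rewrite (indep_law iX us Ds mA').
apply: eq_big_seq => i /(allP Ds) Di.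
have ri0 := indep_rate_gt0 iX Di; have ci0 := c0 _ Di.
have [mu muE] := exponential_probability ri0.
have [nu nuE] := exponential_probability (divr_gt0 ri0 ci0).
rewrite -muE -nuE.
apply: (@measure_unique_itvoy _ (pushforward mu (fun x : M => c i * x : M)%R) nu).
- apply: (@le_lt_trans _ _ (mu setT)); rewrite ?probability_setT ?ltry//.
  by rewrite -(@probability_setT _ _ _ mu); exact: lexx.
- move=> x.
  transitivity (exponential_prob (rate i / c i) `]x, +oo[%classic); last exact/esym/nuE.
  rewrite exponential_tail ?divr_gt0//.
  transitivity (mu `](x / c i)%R, +oo[%classic).
    rewrite /pushforward; congr (mu _); rewrite predeqE => y/=.
    by rewrite !in_itv/= !andbT ltr_pdivrMr// mulrC.
  have maxE : (Num.max (x / c i) 0 = Num.max x 0 / c i)%R.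
    by rewrite maxr_pMl ?mul0r// invr_ge0 ltW.
  by rewrite muE exponential_tail// maxE mulrA mulrAC !mulNr.
- exact: mA.
Qed.

End independent_exponentials.

Lemma indep_reindex d (T : measurableType d) (R : realType) (I J : choiceType)
    (Q : {measure set T -> \bar R}) (X : I -> T -> R) rate (D : pred I)
    (D' : pred J) (phi : J -> I) (psi : I -> J) :
  independent_exponentials Q X rate D ->
  (forall j, D' j -> D (phi j) /\ psi (phi j) = j) ->
  independent_exponentials Q (X \o phi) (rate \o phi) D'.
Proof.
move=> iX DD'; split.
- by move=> j /DD'[Dj _]; exact: (indep_measurable iX).
- by move=> j /DD'[Dj _]; exact: (indep_rate_gt0 iX).
move=> s A us /allP Ds mA.
have phiK : {in s, cancel phi psi} by move=> j /Ds /DD'[].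
transitivity (Q (joint_event X (A \o psi) (map phi s))).
  congr (Q _); rewrite /joint_event big_map.
  by apply: eq_big_seq => j js /=; rewrite phiK.
rewrite (indep_law iX).
- by rewrite big_map; apply: eq_big_seq => j js /=; rewrite phiK.
- by rewrite map_inj_in_uniq// => i j si sj /(congr1 psi); rewrite !phiK.
- by apply/allP => _ /mapP[j /Ds /DD'[Dj _] ->].
- by move=> i; exact: mA.
Qed.

(** * The last-passage recursion *)

Section last_passage_recursion.
Context {R : realType}.
Implicit Types (wt : nat * nat -> R) (i j k m n : nat).

(** The largest weight of an up-right path from (0,0) to (i,j), as a recursion. *)
Fixpoint lprec wt i : nat -> R :=
  match i with
  | 0%N => fix col j := match j with
           | 0%N => wt (0%N, 0%N)
           | j'.+1 => wt (0%N, j'.+1) + col j'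
           end
  | i'.+1 => fix col j := match j with
           | 0%N => wt (i'.+1, 0%N) + lprec wt i' 0
           | j'.+1 => wt (i'.+1, j'.+1) + Num.max (lprec wt i' j'.+1) (col j')
           end
  end.

Lemma lprecS0 wt i : lprec wt i.+1 0 = wt (i.+1, 0%N) + lprec wt i 0.
Proof. by []. Qed.

Lemma lprec0S wt j : lprec wt 0 j.+1 = wt (0%N, j.+1) + lprec wt 0 j.
Proof. by []. Qed.

Lemma lprecSS wt i j : lprec wt i.+1 j.+1 =
  wt (i.+1, j.+1) + Num.max (lprec wt i j.+1) (lprec wt i.+1 j).
Proof. by []. Qed.

Lemma eq_lprec wt wt' i j : wt =1 wt' -> lprec wt i j = lprec wt' i j.
Proof.
move=> e; elim: i j => [|i IH]; elim => [|j IHj].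
- exact: e.
- by rewrite !lprec0S IHj e.
- by rewrite !lprecS0 IH e.
- by rewrite !lprecSS IH IHj e.
Qed.

Lemma lprec_stepr wt i j : wt (i.+1, j) + lprec wt i j <= lprec wt i.+1 j.
Proof. by case: j => [|j]//; rewrite lprecSS lerD2l le_max lexx. Qed.

Lemma lprec_stepu wt i j : wt (i, j.+1) + lprec wt i j <= lprec wt i j.+1.
Proof. by case: i => [|i]//; rewrite lprecSS lerD2l le_max lexx orbT. Qed.

Lemma lprec_transpose wt i j :
  lprec (fun p => wt (p.2, p.1)) i j = lprec wt j i.
Proof.
elim: i j => [|i IH]; elim => [|j IHj] //.
- by rewrite lprec0S lprecS0 IHj.
- by rewrite lprecS0 lprec0S IH.
- by rewrite !lprecSS IH IHj maxC.
Qed.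

Definition shift_weights wt (u : nat * nat) : nat * nat -> R :=
  fun p => wt (u.1 + p.1, u.2 + p.2)%N.

Lemma up_right_r a b : up_right (a, b) (a.+1, b).
Proof. by apply/orP; left. Qed.

Lemma up_right_u a b : up_right (a, b) (a, b.+1).
Proof. by apply/orP; right. Qed.

(** Both inequalities follow paths from their last step; a path of maximal weight
    is built along the recursion. *)
Lemma lpp_lprec wt (u : nat * nat) i j :
  lpp wt u (u.1 + i, u.2 + j)%N = lprec (shift_weights wt u) i j.
Proof.
have [||[pi pipath ->] lpp_ge] := @lpp_max _ wt u (u.1 + i, u.2 + j)%N.
- exact: leq_addr.
- exact: leq_addr.
have upper s : path up_right u s -> exists a b, last u s = (u.1 + a, u.2 + b)%N /\
    \sum_(p <- u :: s) wt p <= lprec (shift_weights wt u) a b.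
  elim/last_ind: s => [_|s q IH].
    exists 0%N, 0%N; rewrite !addn0; split; first by case: (u).
    by rewrite big_seq1/= /shift_weights/= !addn0 -surjective_pairing.
  rewrite rcons_path => /andP[/IH[a [b [lastE sumE]]]].
  rewrite lastE /up_right/= last_rcons -rcons_cons -cats1 big_cat big_seq1/=.
  move=> /orP[] /eqP ->.
    exists a.+1, b; rewrite addnS; split=> //.
    apply: le_trans (lprec_stepr _ _ _).
    by rewrite addrC /shift_weights/= addnS lerD2l.
  exists a, b.+1; rewrite addnS; split=> //.
  apply: le_trans (lprec_stepu _ _ _).
  by rewrite addrC /shift_weights/= addnS lerD2l.
have attained a b : exists2 s, path up_right u s /\ last u s = (u.1 + a, u.2 + b)%N &
    \sum_(p <- u :: s) wt p = lprec (shift_weights wt u) a b.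
  elim: a b => [|a IHa]; elim => [|b IHb].
  - exists [::]; first by rewrite !addn0; split => //; case: (u).
    by rewrite big_seq1/= /shift_weights/= !addn0 -surjective_pairing.
  - have [s [ps ls] sE] := IHb; exists (rcons s (u.1 + 0, u.2 + b.+1)%N).
      split; last by rewrite last_rcons.
      by rewrite rcons_path ps ls (addnS u.2) up_right_u.
    by rewrite -rcons_cons -cats1 big_cat big_seq1 sE lprec0S addrC.
  - have [s [ps ls] sE] := IHa 0%N; exists (rcons s (u.1 + a.+1, u.2 + 0)%N).
      split; last by rewrite last_rcons.
      by rewrite rcons_path ps ls (addnS u.1) up_right_r.
    by rewrite -rcons_cons -cats1 big_cat big_seq1 sE lprecS0 addrC.
  rewrite lprecSS; case: leP => _.
    have [s [ps ls] sE] := IHb; exists (rcons s (u.1 + a.+1, u.2 + b.+1)%N).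
      split; last by rewrite last_rcons.
      by rewrite rcons_path ps ls (addnS u.2) up_right_u.
    by rewrite -rcons_cons -cats1 big_cat big_seq1 sE addrC.
  have [s [ps ls] sE] := IHa b.+1; exists (rcons s (u.1 + a.+1, u.2 + b.+1)%N).
    split; last by rewrite last_rcons.
    by rewrite rcons_path ps ls (addnS u.1) up_right_r.
  by rewrite -rcons_cons -cats1 big_cat big_seq1 sE addrC.
apply/eqP; rewrite eq_le; apply/andP; split.
  move: pipath => [s [ps ls] <-]; have [a [b [lsE]]] := upper _ ps.
  by move: lsE; rewrite ls => -[/addnI <- /addnI <-].
have [s sP <-] := attained i j.
by apply: lpp_ge; exists s.
Qed.

Lemma lprec_shift1 wt i j :
  wt (0%N, 0%N) + lprec (shift_weights wt (1%N, 0%N)) i j <= lprec wt i.+1 j.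
Proof.
elim: i j => [|i IH]; elim => [|j IHj].
- by rewrite lprecS0 addrC.
- rewrite lprec0S addrCA (le_trans _ (lprec_stepu _ _ _))//.
  by rewrite lerD2l.
- by rewrite !lprecS0 addrCA lerD2l; exact: IH.
- rewrite lprecSS addrCA [leRHS]lprecSS lerD2l.
  have := IH j.+1; move: IHj; case: (leP (lprec (shift_weights _ _) i j.+1)) => _.
    by move=> h _; rewrite le_max h orbT.
  by move=> _ h; rewrite le_max h.
Qed.

Lemma lprec_shift1_ver wt i j :
  wt (0%N, 0%N) + lprec (shift_weights wt (0%N, 1%N)) i j <= lprec wt i j.+1.
Proof.
rewrite -lprec_transpose -[leRHS]lprec_transpose.
exact: (lprec_shift1 (fun p => wt (p.2, p.1))).
Qed.

(** Among the paths to (k + i, j) are those that start with [k] horizontal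
    steps on the axis. *)
Lemma lprec_shift wt k i j :
  \sum_(0 <= a < k) wt (a, 0%N) + lprec (shift_weights wt (k, 0%N)) i j <=
  lprec wt (k + i) j.
Proof.
elim: k i => [|k IH] i.
  rewrite big_geq// add0r add0n.
  by rewrite (@eq_lprec _ wt)// => p; rewrite /shift_weights !add0n -surjective_pairing.
rewrite big_nat_recr// -addrA addSnnS; apply: le_trans (IH i.+1).
rewrite lerD2l; apply: le_trans (lprec_shift1 _ _ _).
rewrite /shift_weights/= addn0 lerD2l le_eqVlt; apply/orP; left; apply/eqP.
by apply: eq_lprec => p /=; rewrite addnA addn1.
Qed.

(** A path leaves the origin either to the right or upwards. *)
Lemma lprec_le_max wt i j :
  lprec wt i.+1 j.+1 <=
  wt (0%N, 0%N) + Num.max (lprec (shift_weights wt (1%N, 0%N)) i j.+1)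
                          (lprec (shift_weights wt (0%N, 1%N)) i.+1 j).
Proof.
have col b : lprec wt 0 b.+1 = wt (0%N, 0%N) + lprec (shift_weights wt (0%N, 1%N)) 0 b.
  by elim: b => [|b IH]; [rewrite addrC|rewrite lprec0S IH addrCA].
have row a : lprec wt a.+1 0 = wt (0%N, 0%N) + lprec (shift_weights wt (1%N, 0%N)) a 0.
  by elim: a => [|a IH]; [rewrite addrC|rewrite lprecS0 IH addrCA].
have grow x y X Y c g (w : R) : g <= c + Num.max x y -> w + x <= X -> w + y <= Y ->
    w + g <= c + Num.max X Y.
  move=> gxy xX yY; apply: (@le_trans _ _ (w + (c + Num.max x y))); first by rewrite lerD2l.
  rewrite addrCA lerD2l le_max; case: (leP x y) => _; first by rewrite yY orbT.
  by rewrite xX.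
have stepR a b : wt (a.+1, b.+1) + lprec (shift_weights wt (0%N, 1%N)) a b <=
    lprec (shift_weights wt (0%N, 1%N)) a.+1 b.
  exact: (lprec_stepr (shift_weights wt (0%N, 1%N))).
have stepU a b : wt (a.+1, b.+1) + lprec (shift_weights wt (1%N, 0%N)) a b <=
    lprec (shift_weights wt (1%N, 0%N)) a b.+1.
  exact: (lprec_stepu (shift_weights wt (1%N, 0%N))).
have stepR' a b : wt (a.+2, b.+1) + lprec (shift_weights wt (1%N, 0%N)) a b.+1 <=
    lprec (shift_weights wt (1%N, 0%N)) a.+1 b.+1.
  exact: (lprec_stepr (shift_weights wt (1%N, 0%N))).
have stepU' a b : wt (a.+1, b.+2) + lprec (shift_weights wt (0%N, 1%N)) a.+1 b <=
    lprec (shift_weights wt (0%N, 1%N)) a.+1 b.+1.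
  exact: (lprec_stepu (shift_weights wt (0%N, 1%N))).
have max_split (w x y z : R) : w + x <= z -> w + y <= z -> w + Num.max x y <= z.
  by case: (leP x y).
elim: i j => [|i IHi]; elim => [|j IHj]; rewrite lprecSS; apply: max_split.
- by rewrite col addrCA lerD2l le_max stepR orbT.
- by rewrite row addrCA lerD2l le_max stepU.
- by rewrite col addrCA lerD2l le_max stepR orbT.
- apply: grow IHj _ _; [exact: stepU|exact: stepU'].
- by apply: grow (IHi 0%N) _ _; [exact: stepR'|exact: stepR].
- by rewrite row addrCA lerD2l le_max stepU.
- by apply: grow (IHi j.+1) _ _; [exact: stepR'|exact: stepR].
- by apply: grow IHj _ _; [exact: stepU|exact: stepU'].
Qed.

End last_passage_recursion.

(** * Stationarity of the increments *)

Section stationary_increments.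
Context d (T : measurableType d) (R : realType).
Implicit Types (Q : {measure set T -> \bar R}) (X : nat * nat -> T -> R).

(** [w] on the horizontal axis, [r] on the vertical axis, 1 in the bulk. *)
Definition boundary_rate (w r : R) (p : nat * nat) : R :=
  if p.2 == 0%N then w else if p.1 == 0%N then r else 1.

(** The rows beyond [n] are left out: a change of measure alters the boundary
    rates of finitely many rows only. *)
Definition strip n : pred (nat * nat) :=
  fun p => (p != (0%N, 0%N)) && (p.2 <= n)%N.

Definition lpt X i j (t : T) : R := lprec (fun p => X p t) i j.

Definition hor_inc X i j (t : T) : R := lpt X i j t - lpt X i.-1 j t.

Definition ver_inc X i j (t : T) : R := lpt X i j t - lpt X i j.-1 t.

(** The increments along the down-right path that separates the cells already
    crossed, [j] full rows and the first [i] cells of the next one, from the others;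
    the variable of index (a,0) is the horizontal increment of column [a], that of
    index (0,j + 1) the vertical increment of the current row, and all other variables
    are weights not used so far. *)
Definition frontier X i j (p : nat * nat) : T -> R :=
  if p.2 == 0%N then hor_inc X p.1 (if (p.1 <= i)%N then j.+1 else j)
  else if p == (0%N, j.+1) then ver_inc X i j.+1
  else X p.

Definition frontier_dom m n i j (p : nat * nat) : bool :=
  [&& (p.1 <= m)%N, (p.2 <= n)%N &
  if p.2 == 0%N then (0 < p.1)%N
  else if p.1 == 0%N then (j < p.2)%N
  else ((j.+1 < p.2) || (p.2 == j.+1) && (i < p.1))%N].

(** The recursion for the passage times [x], [y] at the two neighbours, seen from
    their common predecessor [o], is the Burke update of the increments. *)
Lemma recursion_inc (c x y o : R) :
  c + Num.max x y - x = c + Num.max ((y - o) - (x - o)) 0.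
Proof. by case: (leP x y) => h1; case: (leP (y - o - (x - o)) 0) => h2; lra. Qed.

(** Crossing the cells in the order of reading, row after row, each crossing is an
    instance of [burke_step]. *)
Lemma frontier_indep Q X (w : R) m n : 0 < w -> w < 1 ->
  independent_exponentials Q X (boundary_rate w (1 - w)) (strip n) ->
  (forall t, X (0%N, 0%N) t = 0) ->
  forall j i, (j <= n)%N -> (i <= m)%N -> (j < n)%N || (i == 0)%N ->
  independent_exponentials Q (frontier X i j) (boundary_rate w (1 - w))
    (frontier_dom m n i j).
Proof.
move=> w0 w1 iX X0.
have step i j : (i < m)%N -> (j < n)%N ->
    independent_exponentials Q (frontier X i j) (boundary_rate w (1 - w))
      (frontier_dom m n i j) ->
    independent_exponentials Q (frontier X i.+1 j) (boundary_rate w (1 - w))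
      (frontier_dom m n i.+1 j).
  move=> im jn iF.
  have Dabc : [/\ frontier_dom m n i j (i.+1, 0%N), frontier_dom m n i j (0%N, j.+1)
      & frontier_dom m n i j (i.+1, j.+1)].
    by split; rewrite /frontier_dom/= ?im ?jn ?ltnSn ?eqxx ?orbT.
  have rsum : boundary_rate w (1 - w) (i.+1, 0%N) +
      boundary_rate w (1 - w) (0%N, j.+1) = 1.
    by rewrite /boundary_rate/= addrCA subrr addr0.
  have uabc : uniq [:: (i.+1, 0%N); (0%N, j.+1); (i.+1, j.+1)].
    by rewrite /= !inE !xpair_eqE /= andbF.
  apply: (indep_ext (burke_step iF Dabc uabc rsum erefl)) => -[a b].
  rewrite /frontier_dom /burke_update /frontier /= !xpair_eqE.
  case: b => [|b]; case: a => [|a]; rewrite ?andbF ?eqSS //=.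
  - move=> /andP[am _]; rewrite am !eqxx ltnn andbT; split => //.
    have [->|ai] := eqVneq a i; last by rewrite ltnS leq_eqVlt (negbTE ai).
    rewrite ltnSn; apply/funext => t; rewrite /hor_inc /ver_inc /lpt lprecSS /=.
    exact: recursion_inc.
  - move=> /andP[bn jb]; rewrite bn jb; split=> //; rewrite eqxx ltnn.
    case: eqP => // _; apply/funext => t; rewrite /hor_inc /ver_inc /lpt lprecSS /=.
    by rewrite maxC; exact: recursion_inc.
  - move=> /and3P[-> -> h]; split => //; move: h; rewrite !ltnS /=.
    have [->|bj] := eqVneq b j; last by rewrite !orbF andbF => ->.
    by rewrite ltnn /= andbT; case: ltngtP.
have start j : (j < n)%N -> (forall i, (i <= m)%N -> independent_exponentials Q (frontier X i j)
      (boundary_rate w (1 - w)) (frontier_dom m n i j)) ->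
    independent_exponentials Q (frontier X 0 j.+1) (boundary_rate w (1 - w))
      (frontier_dom m n 0 j.+1).
  move=> jn iF; apply: (indep_ext (iF m (leqnn m))) => -[a b].
  rewrite /frontier_dom /frontier /= !xpair_eqE.
  case: b => [|b]; case: a => [|a]; rewrite ?andbF ?eqSS //=.
  - by move=> /andP[-> _].
  - move=> /andP[-> jb]; have -> : (b == j) = false by apply/eqP; lia.
    rewrite (ltnW jb); split => //.
    case: eqP => // bj; rewrite bj; apply/funext => t.
    by rewrite /ver_inc /lpt lprec0S addrK.
  - move=> /and3P[-> -> h]; rewrite /=; split => //.
    by move: h; rewrite !ltnS; case: ltngtP => //; lia.
have zero : independent_exponentials Q (frontier X 0 0) (boundary_rate w (1 - w))
    (frontier_dom m n 0 0).
  apply: (indep_ext iX) => -[a b]; rewrite /frontier_dom /frontier /strip /= !xpair_eqE.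
  case: b => [|b]; case: a => [|a]; rewrite ?andbF ?eqSS //=.
  - move=> _; split => //; apply/funext => t.
    by rewrite /hor_inc /lpt lprecS0 addrK.
  - move=> /andP[-> _]; split => //; case: eqP => // ->; apply/funext => t.
    by rewrite /ver_inc /lpt lprec0S addrK.
  - by move=> /and3P[_ -> _].
elim=> [|j IHj]; elim => [|i IHi] jn im ij.
- exact: zero.
- by rewrite orbF in ij; apply: step => //; apply: IHi => //; [exact: ltnW|rewrite ij].
- by apply: start => // i im'; apply: IHj; rewrite ?jn// ltnW.
- by rewrite orbF in ij; apply: step => //; apply: IHi => //; [exact: ltnW|rewrite ij].
Qed.

Lemma north_increments Q X (w : R) m n : 0 < w -> w < 1 ->
  independent_exponentials Q X (boundary_rate w (1 - w)) (strip n) ->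
  (forall t, X (0%N, 0%N) t = 0) ->
  independent_exponentials Q (fun i => hor_inc X i n) (fun=> w)
    (fun i : nat => (0 < i <= m)%N).
Proof.
move=> w0 w1 iX X0.
have iF := frontier_indep w0 w1 iX X0 (leqnn n) (leq0n m) (orbT _).
apply: (indep_ext (indep_reindex (phi := fun i => (i, 0%N)) (psi := fst)
  (D' := fun i : nat => (0 < i <= m)%N) iF _)) => [i /andP[i0 im]|i /andP[i0 im]].
  by split => //; rewrite /frontier_dom/= im.
by split => //; [rewrite i0|rewrite /= /frontier/= leqNgt i0].
Qed.

End stationary_increments.

(** * Exponential moments *)

Section exponential_moments.
Context d (T : measurableType d) (R : realType).

Lemma prod_const_seq (I : Type) (l : seq I) (c : R) : \prod_(i <- l) c = c ^+ size l.
Proof. by rewrite big_const_seq count_predT iter_mulr_1. Qed.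

Lemma measurable_sum_seq (I : eqType) (X : I -> T -> R) (l : seq I) :
  (forall i, i \in l -> measurable_fun setT (X i)) ->
  measurable_fun setT (fun t => \sum_(i <- l) X i t).
Proof.
elim: l => [|a l IH] mX.
  under eq_fun do rewrite big_nil.
  exact: measurable_cst.
under eq_fun do rewrite big_cons.
apply: measurable_funD; first by apply: mX; exact: mem_head.
by apply: IH => i il; apply: mX; rewrite inE il orbT.
Qed.

(** The integrand is a constant times the density that lowers every rate by [c],
    and that density has integral 1. *)
Lemma laplace_sum (I : choiceType) (Q : {measure set T -> \bar R})
    (X : I -> T -> R) (rate : I -> R) (D : pred I) (l : seq I) (c : R) :
  independent_exponentials Q X rate D -> uniq l -> all D l ->
  (forall i, i \in l -> c < rate i) ->
  (\int[Q]_t (expR (c * \sum_(i <- l) X i t))%:E =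
   (\prod_(i <- l) (rate i / (rate i - c)))%:E)%E.
Proof.
move=> iX ul Dl cr.
have r0 i : i \in l -> 0 < rate i.
  by move=> il; apply: (indep_rate_gt0 iX); exact: (allP Dl).
have [|Q' [iQ' Q'int]] := @tilt_exponentials _ _ _ _ _ _ _ (fun i => rate i - c) _ _ iX ul Dl.
  by move=> i /cr; rewrite subr_gt0.
pose K := \prod_(i <- l) ((rate i - c) / rate i).
have K0 : 0 < K.
  rewrite /K big_seq; apply: prodr_gt0 => i il.
  by rewrite divr_gt0 ?r0// subr_gt0 cr.
have tiltE t : tilt X rate (fun i => rate i - c) l t = K * expR (c * \sum_(i <- l) X i t).
  rewrite /tilt big_split/= -/K; congr (_ * _).
  by rewrite mulr_sumr expR_sum; apply: eq_bigr => i _; rewrite opprB addrCA subrr addr0.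
have mX i : i \in l -> measurable_fun setT (X i).
  by move=> il; apply: (indep_measurable iX); exact: (allP Dl).
have mS : measurable_fun setT (fun t => expR (c * \sum_(i <- l) X i t)).
  apply: measurableT_comp => //; apply: measurable_funM => //.
  exact: measurable_sum_seq.
have := Q'int (fun=> 1%E) (measurable_cst _) (fun=> lee01).
rewrite integral_cst// (indep_setT iQ') mule1.
under eq_integral do rewrite mule1 tiltE EFinM.
rewrite ge0_integralZl// ?lee_fin ?(ltW K0)//; last exact/measurable_EFinP.
move=> KE; rewrite -[LHS]mul1e [X in (X * _)%E](_ : 1%E = (K^-1)%:E * K%:E)%E; last first.
  by rewrite -EFinM mulVf ?gt_eqF.
rewrite -muleA -KE mule1 /K -prodfV; congr EFin; apply: eq_bigr => i _.
by rewrite invf_div.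
Qed.

Implicit Types (Q : {measure set T -> \bar R}) (X : nat * nat -> T -> R).

Definition west_axis n : seq (nat * nat) := [seq (0%N, j) | j <- iota 1 n].

(** Walk up the west side, then along the north side. *)
Lemma lpt_split X m n t : X (0%N, 0%N) t = 0 ->
  lpt X m n t = \sum_(p <- west_axis n) X p t + \sum_(i <- iota 1 m) hor_inc X i n t.
Proof.
move=> X0; elim: m => [|m IH].
  rewrite big_nil addr0; elim: n => [|n IHn]; first by rewrite big_nil.
  rewrite /west_axis (_ : iota 1 n.+1 = iota 1 n ++ [:: n.+1]); last first.
    by rewrite -(addn1 n) iotaD add1n addn1.
  by rewrite map_cat big_cat/= big_seq1 -IHn addrC.
rewrite (_ : iota 1 m.+1 = iota 1 m ++ [:: m.+1]); last first.
  by rewrite -(addn1 m) iotaD add1n addn1.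
by rewrite big_cat/= big_seq1 addrA -IH /hor_inc/= addrC subrK.
Qed.

Lemma measurable_lpt X m n : (forall p, (p.2 <= n)%N -> measurable_fun setT (X p)) ->
  measurable_fun setT (lpt X m n).
Proof.
move=> mX.
suff h j : (j <= n)%N -> measurable_fun setT (lpt X m j) by exact: h.
elim: m j => [|m IHm]; elim=> [|j IHj] jn.
- exact: (mX (0%N, 0%N)).
- by apply: measurable_funD; [exact: (mX (0%N, j.+1))|apply: IHj; exact: ltnW].
- by apply: measurable_funD; [exact: (mX (m.+1, 0%N))|exact: IHm].
- apply: measurable_funD; first exact: (mX (m.+1, j.+1)).
  by apply: measurable_maxr; [exact: IHm|apply: IHj; exact: ltnW].
Qed.

Lemma strip_measurable Q X rate n p : independent_exponentials Q X rate (strip n) ->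
  (forall t, X (0%N, 0%N) t = 0) -> (p.2 <= n)%N -> measurable_fun setT (X p).
Proof.
move=> iX X0 pn; have [->|p0] := eqVneq p (0%N, 0%N); last first.
  by apply: (indep_measurable iX); rewrite /strip p0.
have -> : X (0%N, 0%N) = cst 0 by apply/funext => t; rewrite X0.
exact: measurable_cst.
Qed.

(** Under the measure that changes the vertical rates to [1 - w] the recursion is
    stationary.  The density of this change is a constant times
    exp ((w - z) (sum of the west side)), so what remains of exp ((w - z) G) is the
    exponential of the sum of the north side, made of independent Exp(w) variables. *)
Lemma mgf_boundary Q X (w z : R) m n : 0 < z -> z < w -> w < 1 ->
  independent_exponentials Q X (boundary_rate w (1 - z)) (strip n) ->
  (forall t, X (0%N, 0%N) t = 0) ->
  (\int[Q]_t (expR ((w - z) * lpt X m n t))%:E =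
   ((w / z) ^+ m * ((1 - z) / (1 - w)) ^+ n)%:E)%E.
Proof.
move=> z0 zw w1 iX X0.
have w0 := lt_trans z0 zw.
have ul : uniq (west_axis n) by rewrite map_inj_uniq ?iota_uniq// => i j [].
have Dl : all (strip n) (west_axis n).
  apply/allP => p /mapP[j]; rewrite mem_iota => /andP[j0 jn] ->.
  by rewrite /strip/= xpair_eqE/= -ltnS -(add1n n) jn -lt0n j0.
have inl j : (0 < j <= n)%N -> (0%N, j) \in west_axis n.
  move=> /andP[j0 jn]; apply/mapP; exists j => //.
  by rewrite mem_iota j0 add1n ltnS.
have w1' : 0 < 1 - w by rewrite subr_gt0.
have z1' : 0 < 1 - z by rewrite subr_gt0 (lt_trans zw).
have [Q' [iQ' Q'int]] := tilt_exponentials (rate' := fun=> 1 - w) iX ul Dl (fun _ _ => w1').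
have iQ : independent_exponentials Q' X (boundary_rate w (1 - w)) (strip n).
  apply: (indep_ext iQ') => p Dp; split => //; rewrite /boundary_rate.
  case: (boolP (p \in west_axis n)) => [/mapP[j]|nl].
    by rewrite mem_iota => /andP[j0 _] -> /=; rewrite gtn_eqF.
  have [//|b0] := eqVneq p.2 0%N; have [a0|//] := eqVneq p.1 0%N.
  case/andP: Dp => _ pn; case/negP: nl.
  by rewrite (surjective_pairing p) a0 inl// lt0n b0.
have iN := north_increments m w0 w1 iQ X0.
have tiltE t : tilt X (boundary_rate w (1 - z)) (fun=> 1 - w) (west_axis n) t =
    ((1 - w) / (1 - z)) ^+ n * expR ((w - z) * \sum_(p <- west_axis n) X p t).
  rewrite mulr_sumr expR_sum -[X in _ ^+ X](size_iota 1 n) -(size_map (pair 0%N)).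
  rewrite -prod_const_seq -big_split /tilt /=; apply: eq_big_seq => p /mapP[j].
  rewrite mem_iota => /andP[j0 _] ->; rewrite /boundary_rate/= gtn_eqF//.
  by rewrite (_ : 1 - z - (1 - w) = w - z); last ring.
have mX p : (p.2 <= n)%N -> measurable_fun setT (X p) by exact: strip_measurable iX X0.
have minc i : measurable_fun setT (hor_inc X i n).
  by apply: measurable_funB; apply: measurable_lpt.
have Dm : all (fun i : nat => (0 < i <= m)%N) (iota 1 m).
  by apply/allP => i; rewrite mem_iota add1n ltnS.
have cw i : i \in iota 1 m -> w - z < w by rewrite ltrBlDr ltrDl.
have := laplace_sum iN (iota_uniq 1 m) Dm cw.
have mf : measurable_fun setT (fun t => expR ((w - z) * \sum_(i <- iota 1 m) hor_inc X i n t)).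
  apply: measurableT_comp => //; apply: measurable_funM => //.
  exact: measurable_sum_seq.
rewrite Q'int; last 2 first.
- exact/measurable_EFinP.
- by move=> t; rewrite lee_fin expR_ge0.
have -> : \prod_(i <- iota 1 m) (w / (w - (w - z))) = (w / z) ^+ m.
  by rewrite prod_const_seq size_iota; congr ((_ / _) ^+ _); ring.
move=> intE; rewrite [X in _ = X%:E]mulrC EFinM -intE.
have K0 : 0 <= ((1 - z) / (1 - w)) ^+ n by rewrite exprn_ge0// divr_ge0// ltW.
rewrite -ge0_integralZl// ?lee_fin//; last 2 first.
- apply: emeasurable_funM; apply/measurable_EFinP => //.
  apply: measurable_tilt => p pl; apply: (indep_measurable iX); exact: (allP Dl).
- move=> t _; rewrite lee_fin mulr_ge0 ?expR_ge0//; apply: tilt_ge0 => // p pl.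
  by apply: (indep_rate_gt0 iX); exact: (allP Dl).
apply: eq_integral => t _; rewrite tiltE -!EFinM; congr EFin.
have KK : ((1 - z) / (1 - w)) ^+ n * ((1 - w) / (1 - z)) ^+ n = 1.
  by rewrite -exprMn mulrA divfK ?gt_eqF// divff ?gt_eqF// expr1n.
by rewrite lpt_split// mulrDr expRD -mulrA [RHS]mulrA KK mul1r.
Qed.

End exponential_moments.

Section exponential_inequalities.
Context {R : realType}.
Implicit Types x y : R.

Lemma expR_ge_quadratic x : 0 <= x -> 1 + x + x ^+ 2 / 2 <= expR x.
Proof.
move=> x0; rewrite /expR.
have nd : nondecreasing_seq (series (exp_coeff x)).
  apply/nondecreasing_seqP => n; rewrite seriesSr lerDl /exp_coeff/=.
  by rewrite divr_ge0// exprn_ge0.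
apply: le_trans (nondecreasing_cvgn_le nd (is_cvg_series_exp_coeff x) 3).
rewrite /series/= !big_nat_recr//= big_geq// /exp_coeff/= add0r expr0 expr1.
by rewrite !divr1.
Qed.

(** That is, - ln (1 - y) <= y + y^2 / 2 + y^3: the cubic remainder is the price
    for an exact quadratic term, whose cancellation gives the scale of the
    fluctuations. *)
Lemma ge1_exp_mul1B y : 0 <= y -> y <= 2^-1 ->
  1 <= (1 - y) * expR (y + y ^+ 2 / 2 + y ^+ 3).
Proof.
move=> y0 y1; have u0 : 0 <= y + y ^+ 2 / 2 + y ^+ 3.
  by rewrite !addr_ge0 ?divr_ge0 ?exprn_ge0.
apply: le_trans (ler_wpM2l _ (expR_ge_quadratic u0)); last by lra.
rewrite -subr_ge0.
have -> : (1 - y) * (1 + (y + y ^+ 2 / 2 + y ^+ 3) +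
      (y + y ^+ 2 / 2 + y ^+ 3) ^+ 2 / 2) - 1 =
    y ^+ 3 * (2^-1 - 3 / 8 * y - 5 / 8 * y ^+ 2 - y ^+ 4 / 2) by field.
rewrite mulr_ge0 ?exprn_ge0//.
have y2 : y ^+ 2 <= 4^-1 by rewrite expr2; nra.
have y4 : y ^+ 4 <= 16^-1.
  have : y ^+ 2 * y ^+ 2 <= 4^-1 * 4^-1 by apply: ler_pM; rewrite ?sqr_ge0.
  by rewrite -exprD; lra.
lra.
Qed.

(** That is, ln (1 + y) <= y - y^2 / 2 + y^3. *)
Lemma ge1D_exp y : 0 <= y -> 1 + y <= expR (y - y ^+ 2 / 2 + y ^+ 3).
Proof.
move=> y0; have v0 : 0 <= y - y ^+ 2 / 2 + y ^+ 3.
  have -> : y - y ^+ 2 / 2 + y ^+ 3 = y * (1 - y / 2 + y ^+ 2) by ring.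
  by rewrite mulr_ge0//; nra.
apply: le_trans (expR_ge_quadratic v0); rewrite -subr_ge0.
have -> : 1 + (y - y ^+ 2 / 2 + y ^+ 3) + (y - y ^+ 2 / 2 + y ^+ 3) ^+ 2 / 2 -
    (1 + y) = y ^+ 3 / 2 + y ^+ 2 * (y ^+ 2 * (9 / 8 - y / 2 + y ^+ 2 / 2)) by field.
rewrite addr_ge0 ?divr_ge0 ?exprn_ge0// !mulr_ge0 ?sqr_ge0//; nra.
Qed.

Lemma inv1B_le_exp y m : 0 <= y -> y <= 2^-1 ->
  ((1 - y)^-1) ^+ m <= expR (m%:R * (y + y ^+ 2 / 2 + y ^+ 3)).
Proof.
move=> y0 y1; rewrite mulrC expRM_natr; apply: lerXn2r.
- by rewrite nnegrE invr_ge0; lra.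
- by rewrite nnegrE expR_ge0.
by rewrite -div1r ler_pdivrMr 1?mulrC ?ge1_exp_mul1B//; lra.
Qed.

Lemma exp1D_le_exp y m : 0 <= y ->
  (1 + y) ^+ m <= expR (m%:R * (y - y ^+ 2 / 2 + y ^+ 3)).
Proof.
move=> y0; rewrite mulrC expRM_natr; apply: lerXn2r.
- by rewrite nnegrE; lra.
- by rewrite nnegrE expR_ge0.
exact: ge1D_exp.
Qed.

End exponential_inequalities.

Lemma eq_lprec_le (R : realType) n (wt wt' : nat * nat -> R) i j :
  (forall p, (p.2 <= n)%N -> wt p = wt' p) -> (j <= n)%N ->
  lprec wt i j = lprec wt' i j.
Proof.
move=> e; elim: i j => [|i IH]; elim => [|j IHj] jn.
- exact: e.
- by rewrite !lprec0S IHj ?e// ltnW.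
- by rewrite !lprecS0 IH// e.
- by rewrite !lprecSS IH// IHj ?e// ltnW.
Qed.

Section one_sided_moments.
Context d (T : measurableType d) (R : realType).
Implicit Types (Q : {measure set T -> \bar R}) (X : nat * nat -> T -> R).

(** The passage time from (1,0) to (m + 1, n). *)
Definition hor_lpt X m n (t : T) : R :=
  lprec (shift_weights (fun p => X p t) (1%N, 0%N)) m n.

(** The passage time from (0,1) to (m, n + 1). *)
Definition ver_lpt X m n (t : T) : R :=
  lprec (shift_weights (fun p => X p t) (0%N, 1%N)) m n.

(** Multiplying a boundary by a constant changes its rate, so that one family of
    weights provides all the boundary rates. *)
Definition rescale (a b : R) X (p : nat * nat) (t : T) : R :=
  (if p.2 == 0%N then a else if p.1 == 0%N then b else 1) * X p t.

Lemma rescale_indep Q X (w r a b : R) n : 0 < a -> 0 < b ->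
  independent_exponentials Q X (boundary_rate w r) (strip n) ->
  independent_exponentials Q (rescale a b X) (boundary_rate (w / a) (r / b)) (strip n).
Proof.
move=> a0 b0 iX.
pose c (p : nat * nat) := if p.2 == 0%N then a else if p.1 == 0%N then b else 1.
have c0 p : strip n p -> 0 < c p by rewrite /c; do 2 case: ifP => //.
apply: (indep_ext (indep_scale iX c0)) => p Dp; split => //.
by rewrite /boundary_rate /c; do 2 case: ifP => //; rewrite divr1.
Qed.

Lemma rescale_origin a b X t : X (0%N, 0%N) t = 0 -> rescale a b X (0%N, 0%N) t = 0.
Proof. by rewrite /rescale => ->; rewrite mulr0. Qed.

Lemma hor_rescale b X m n t : hor_lpt (rescale 1 b X) m n t = hor_lpt X m n t.
Proof.
apply: eq_lprec => p; rewrite /shift_weights /rescale /=.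
by case: ifP; rewrite mul1r.
Qed.

Lemma ver_rescale a X m n t : ver_lpt (rescale a 1 X) m n t = ver_lpt X m n t.
Proof.
apply: eq_lprec => p; rewrite /shift_weights /rescale /=.
by case: ifP; rewrite mul1r.
Qed.

Lemma hor_le_lpt X m n t : X (0%N, 0%N) t = 0 -> hor_lpt X m n t <= lpt X m.+1 n t.
Proof. by move=> X0; rewrite (le_trans _ (lprec_shift1 _ _ _))// X0 add0r. Qed.

Lemma ver_le_lpt X m n t : X (0%N, 0%N) t = 0 -> ver_lpt X m n t <= lpt X m n.+1 t.
Proof. by move=> X0; rewrite (le_trans _ (lprec_shift1_ver _ _ _))// X0 add0r. Qed.

Lemma lpt_le_max X m n t : X (0%N, 0%N) t = 0 ->
  lpt X m.+1 n.+1 t <= Num.max (hor_lpt X m n.+1 t) (ver_lpt X m.+1 n t).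
Proof. by move=> X0; rewrite (le_trans (lprec_le_max _ _ _))// X0 add0r. Qed.

Lemma measurable_hor_lpt Q X rate m n :
  independent_exponentials Q X rate (strip n) -> measurable_fun setT (hor_lpt X m n).
Proof.
move=> iX.
have -> : hor_lpt X m n = lpt (fun p => if (p.2 <= n)%N then X (1 + p.1, 0 + p.2)%N else cst 0) m n.
  by apply/funext => t; apply: (@eq_lprec_le _ n) => // p pn; rewrite pn.
apply: measurable_lpt => p pn; rewrite pn; apply: (indep_measurable iX).
by rewrite /strip/= pn.
Qed.

Lemma measurable_ver_lpt Q X rate m n :
  independent_exponentials Q X rate (strip n.+1) -> measurable_fun setT (ver_lpt X m n).
Proof.
move=> iX.
have -> : ver_lpt X m n = lpt (fun p => if (p.2 <= n)%N then X (0 + p.1, 1 + p.2)%N else cst 0) m n.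
  by apply/funext => t; apply: (@eq_lprec_le _ n) => // p pn; rewrite pn.
apply: measurable_lpt => p pn; rewrite pn; apply: (indep_measurable iX).
by rewrite /strip/= ?xpair_eqE/= ?andbF ?ltnS.
Qed.

(** The horizontal passage time ignores the vertical boundary.  Giving that
    boundary the rate 1 - (w - l) bounds it by a passage time with known exponential
    moment of order [l]. *)
Lemma mgf_hor Q X (w r l : R) m n : 0 < l -> l < w -> w < 1 -> 0 < r ->
  independent_exponentials Q X (boundary_rate w r) (strip n) ->
  (forall t, X (0%N, 0%N) t = 0) ->
  (\int[Q]_t (expR (l * hor_lpt X m n t))%:E <=
   ((w / (w - l)) ^+ m.+1 * ((1 - (w - l)) / (1 - w)) ^+ n)%:E)%E.
Proof.
move=> l0 lw w1 r0 iX X0.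
have [b [b0 rbE]] : exists b, 0 < b /\ r / b = 1 - (w - l).
  exists (r / (1 - (w - l))); split; first by rewrite divr_gt0//; lra.
  by rewrite invf_div mulrCA divff ?mulr1 ?gt_eqF.
have iY : independent_exponentials Q (rescale 1 b X)
    (boundary_rate w (1 - (w - l))) (strip n).
  by have := rescale_indep ltr01 b0 iX; rewrite divr1 rbE.
have z0 : 0 < w - l by lra.
have zw : w - l < w by lra.
have Y0 t : rescale 1 b X (0%N, 0%N) t = 0 by exact: rescale_origin.
rewrite -(mgf_boundary m.+1 z0 zw w1 iY Y0).
apply: ge0_le_integral => //.
- apply/measurable_EFinP; apply: measurableT_comp => //; apply: measurable_funM => //.
  exact: measurable_hor_lpt iX.
- apply/measurable_EFinP; apply: measurableT_comp => //; apply: measurable_funM => //.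
  by apply: measurable_lpt => p; exact: strip_measurable iY Y0.
move=> t _; rewrite lee_fin ler_expR opprB addrCA subrr addr0.
apply: ler_wpM2l; first exact: ltW.
by rewrite -(hor_rescale b); exact: hor_le_lpt.
Qed.

(** The counterpart of [mgf_hor], with the horizontal boundary at rate [w + h]. *)
Lemma mgf_ver Q X (w h : R) m n : 0 < w -> 0 < h -> h < 1 - w ->
  independent_exponentials Q X (boundary_rate w (1 - w)) (strip n.+1) ->
  (forall t, X (0%N, 0%N) t = 0) ->
  (\int[Q]_t (expR (h * ver_lpt X m n t))%:E <=
   (((w + h) / w) ^+ m * ((1 - w) / (1 - (w + h))) ^+ n.+1)%:E)%E.
Proof.
move=> w0 h0 hw iX X0.
have wh0 : 0 < w + h by lra.
have [a [a0 waE]] : exists a, 0 < a /\ w / a = w + h.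
  exists (w / (w + h)); split; first by rewrite divr_gt0.
  by rewrite invf_div mulrCA divff ?mulr1 ?gt_eqF.
have iY : independent_exponentials Q (rescale a 1 X)
    (boundary_rate (w + h) (1 - w)) (strip n.+1).
  by have := rescale_indep a0 ltr01 iX; rewrite divr1 waE.
have zw : w < w + h by lra.
have w1 : w + h < 1 by lra.
have Y0 t : rescale a 1 X (0%N, 0%N) t = 0 by exact: rescale_origin.
rewrite -(mgf_boundary m w0 zw w1 iY Y0).
apply: ge0_le_integral => //.
- apply/measurable_EFinP; apply: measurableT_comp => //; apply: measurable_funM => //.
  exact: measurable_ver_lpt iX.
- apply/measurable_EFinP; apply: measurableT_comp => //; apply: measurable_funM => //.
  by apply: measurable_lpt => p; exact: strip_measurable iY Y0.
move=> t _; rewrite lee_fin ler_expR addrAC subrr add0r.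
apply: ler_wpM2l; first exact: ltW.
by rewrite -(ver_rescale a); exact: ver_le_lpt.
Qed.

End one_sided_moments.

(** * The lower tail of the horizontal passage time *)

Section lower_tail.
Context d (T : measurableType d) (R : realType).
Implicit Types (Q : {measure set T -> \bar R}) (X : nat * nat -> T -> R).

Lemma laplace_one (I : choiceType) Q (X : I -> T -> R) rate (D : pred I) i c :
  independent_exponentials Q X rate D -> D i -> c < rate i ->
  (\int[Q]_t (expR (c * X i t))%:E = (rate i / (rate i - c))%:E)%E.
Proof.
move=> iX Di cr; have /= := laplace_sum (l := [:: i]) (c := c) iX isT.
rewrite big_seq1 Di => <- //; last by move=> j; rewrite inE => /eqP ->.
by apply: eq_integral => t _; rewrite big_seq1.
Qed.

Lemma integral_sum_laplace (I : choiceType) Q (X : I -> T -> R) r (D : pred I) s k :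
  independent_exponentials Q X (fun=> r) D -> all D s -> 0 < k ->  0 < r ->
  (\int[Q]_t (\sum_(i <- s) expR (- k * X i t))%:E = ((size s)%:R * (r / (r + k)))%:E)%E.
Proof.
move=> iX + k0 r0; elim: s => [_|i s IH /= /andP[Di Ds]].
  by under eq_integral do rewrite big_nil; rewrite integral0 mul0r.
have mX j : j \in i :: s -> measurable_fun setT (X j).
  rewrite inE => js; apply: (indep_measurable iX).
  by case/predU1P: js => [->|/(allP Ds)].
have mE j : j \in i :: s -> measurable_fun setT (fun t => expR (- k * X j t)).
  by move=> js; apply: measurableT_comp => //; apply: measurable_funM => //; exact: mX.
under eq_integral do rewrite big_cons EFinD.
rewrite ge0_integralD//; last 3 first.
- by apply/measurable_EFinP; apply: mE; exact: mem_head.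
- by move=> t _; rewrite lee_fin sumr_ge0// => j _; exact: expR_ge0.
- apply/measurable_EFinP; apply: measurable_sum_seq => j js; apply: mE.
  by rewrite inE js orbT.
rewrite IH// (laplace_one iX)//; last by lra.
by rewrite -EFinD opprK; congr EFin; rewrite -[_.+1]add1n natrD mulrDl mul1r.
Qed.

Lemma expR_tangent (k y : R) : 0 < k -> k^-1 - k^-1 * expR (- k * y) <= y.
Proof.
move=> k0; have := expR_ge1Dx (- k * y).
rewrite -(ler_pM2l (_ : 0 < k^-1)) ?invr_gt0// mulrDr mulr1.
have -> : k^-1 * (- k * y) = - y by field; rewrite gt_eqF.
lra.
Qed.

Lemma le_expR_scaled (l y : R) : 0 < l -> y <= l^-1 * expR (l * y).
Proof.
move=> l0; rewrite -ler_pdivrMl ?invr_gt0// invrK.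
by apply: le_trans (expR_ge1Dx _); rewrite lerDr.
Qed.

(** If the horizontal time [H] is below [M - x], the maximum exceeds [M - x] only
    through [V]. *)
Lemma max_tail (H V M x l h : R) : 0 < l -> 0 < h -> 0 <= x ->
  x * (H < M - x)%R%:R + Num.max H V - M <=
  l^-1 * expR (l * (H - M)) + h^-1 * expR (h * (V - M + x)).
Proof.
move=> l0 h0 x0.
have e1 := le_expR_scaled (H - M) l0; have e2 := le_expR_scaled (V - M + x) h0.
have p1 : 0 <= l^-1 * expR (l * (H - M)) by rewrite mulr_ge0 ?expR_ge0 ?invr_ge0 ?ltW.
have p2 : 0 <= h^-1 * expR (h * (V - M + x)) by rewrite mulr_ge0 ?expR_ge0 ?invr_ge0 ?ltW.
by case: (ltP H (M - x)) => HM; rewrite ?mulr1 ?mulr0; case: (leP H V) => HV; lra.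
Qed.

Lemma tangent_pointwise (s : seq R) (k : R) : 0 < k ->
  (size s)%:R / k - k^-1 * \sum_(y <- s) expR (- k * y) <= \sum_(y <- s) y.
Proof.
move=> k0; elim: s => [|y s IH]; first by rewrite !big_nil mul0r mulr0 subr0.
rewrite !big_cons -[(size _)%:R]/((size s).+1%:R) -[_.+1]addn1 natrD.
have := expR_tangent y k0; move: IH; set A := \sum_(_ <- _) expR _; set B := \sum_(_ <- _) _.
rewrite mulrDl mul1r mulrDr; lra.
Qed.

(** The mean of the stationary passage time is bounded from below through
    k^-1 (1 - exp (- k y)) <= y, applied to each boundary increment.  All integrands
    are then nonnegative, so that integrability never has to be discussed, and the
    error disappears as [k] tends to 0. *)
Lemma stationary_bound_aux Q X (w x l h k bH bV : R) m n
    (M := m.+1%:R / w + n.+1%:R / (1 - w)) :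
  0 < w -> w < 1 -> 0 < l -> 0 < h -> 0 <= x -> 0 < k ->
  independent_exponentials Q X (boundary_rate w (1 - w)) (strip n.+1) ->
  (forall t, X (0%N, 0%N) t = 0) ->
  (\int[Q]_t (expR (l * (hor_lpt X m n.+1 t - M)))%:E <= bH%:E)%E ->
  (\int[Q]_t (expR (h * (ver_lpt X m.+1 n t - M + x)))%:E <= bV%:E)%E ->
  x * fine (Q [set t | hor_lpt X m n.+1 t < M - x]) +
    (m.+1%:R / (w + k) + n.+1%:R / (1 - w + k)) <= M + bH / l + bV / h.
Proof.
move=> w0 w1 l0 h0 x0 k0 iX X0 HE VE.
have w1' : 0 < 1 - w by lra.
pose A := [set t | hor_lpt X m n.+1 t < M - x].
have mH : measurable_fun setT (hor_lpt X m n.+1) by exact: measurable_hor_lpt iX.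
have mV : measurable_fun setT (ver_lpt X m.+1 n) by exact: measurable_ver_lpt iX.
have mA : measurable A.
  rewrite (_ : A = hor_lpt X m n.+1 @^-1` `]-oo, M - x[%classic); last first.
    by rewrite predeqE => t; rewrite /A/= in_itv/=.
  by rewrite -[X in measurable X]setTI; exact: mH.
have QAfin : Q A \is a fin_num.
  rewrite ge0_fin_numE// (@le_lt_trans _ _ 1%E) ?ltry//.
  by rewrite -(indep_setT iX) le_measure// inE.
have iN := north_increments m.+1 w0 w1 iX X0.
have [W WE] : exists W, W = west_axis n.+1 by exists (west_axis n.+1).
have sW : size W = n.+1 by rewrite WE size_map size_iota.
have iW : independent_exponentials Q X (fun=> 1 - w) (fun p => p \in W).
  apply: (indep_ext iX) => p; rewrite WE => /mapP[j]; rewrite mem_iota => /andP[j0 jn] ->.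
  by rewrite /strip /boundary_rate/= xpair_eqE/= gtn_eqF// -ltnS -[n.+2]add1n jn.
pose S1 t := \sum_(p <- W) expR (- k * X p t).
pose S2 t := \sum_(i <- iota 1 m.+1) expR (- k * hor_inc X i n.+1 t).
have S1int : (\int[Q]_t (S1 t)%:E = (n.+1%:R * ((1 - w) / (1 - w + k)))%:E)%E.
  by rewrite (integral_sum_laplace iW)// ?sW//; exact/allP.
have S2int : (\int[Q]_t (S2 t)%:E = (m.+1%:R * (w / (w + k)))%:E)%E.
  rewrite (integral_sum_laplace iN)// ?size_iota//.
  by apply/allP => i; rewrite mem_iota add1n ltnS.
have mexp (f : T -> R) : measurable_fun setT f -> measurable_fun setT (fun t => expR (f t)).
  by move=> mf; exact: measurableT_comp.
have mX p : (p.2 <= n.+1)%N -> measurable_fun setT (X p) by exact: strip_measurable iX X0.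
have mS1 : measurable_fun setT S1.
  apply: measurable_sum_seq => p /(indep_measurable iW) mp.
  by apply: mexp; exact: measurable_funM.
have mS2 : measurable_fun setT S2.
  apply: measurable_sum_seq => i il; apply: mexp; apply: measurable_funM => //.
  by apply: measurable_funB; apply: measurable_lpt.
have S1ge0 t : 0 <= S1 t by rewrite sumr_ge0// => *; exact: expR_ge0.
have S2ge0 t : 0 <= S2 t by rewrite sumr_ge0// => *; exact: expR_ge0.
pose E1 t := expR (l * (hor_lpt X m n.+1 t - M)).
pose E2 t := expR (h * (ver_lpt X m.+1 n t - M + x)).
have mE1 : measurable_fun setT E1.
  by apply: mexp; apply: measurable_funM => //; exact: measurable_funB.
have mE2 : measurable_fun setT E2.
  apply: mexp; apply: measurable_funM => //.
  by apply: measurable_funD => //; exact: measurable_funB.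
pose c1 := (m.+1%:R + n.+1%:R) / k.
have c10 : 0 <= c1 by rewrite divr_ge0 ?addr_ge0// ltW.
have M0 : 0 <= M by rewrite /M addr_ge0// divr_ge0// ltW.
pose lhs t := x * \1_A t + c1.
pose rhs t := M + (k^-1 * (S1 t + S2 t) + (l^-1 * E1 t + h^-1 * E2 t)).
have lhs_rhs t : lhs t <= rhs t.
  rewrite /lhs /rhs.
  have -> : \1_A t = (hor_lpt X m n.+1 t < M - x)%R%:R :> R.
    by rewrite indicE /A mem_setE.
  have -> : c1 = m.+1%:R / k + n.+1%:R / k by rewrite /c1 mulrDl.
  have := max_tail (hor_lpt X m n.+1 t) (ver_lpt X m.+1 n t) M l0 h0 x0.
  have := lpt_le_max m n (X0 t); rewrite lpt_split// -WE.
  have := tangent_pointwise [seq X p t | p <- W] k0.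
  have := tangent_pointwise [seq hor_inc X i n.+1 t | i <- iota 1 m.+1] k0.
  rewrite !big_map !size_map sW size_iota -/(S1 t) -/(S2 t) -/(E1 t) -/(E2 t).
  rewrite (mulrDr k^-1); lra.
have intD (f g : T -> R) : measurable_fun setT f -> measurable_fun setT g ->
    (forall t, 0 <= f t) -> (forall t, 0 <= g t) ->
    (\int[Q]_t (f t + g t)%:E = \int[Q]_t (f t)%:E + \int[Q]_t (g t)%:E)%E.
  move=> mf mg f0 g0; under eq_integral do rewrite EFinD.
  rewrite ge0_integralD//; try by [exact/measurable_EFinP|move=> t _; rewrite lee_fin].
have intZ (c : R) (f : T -> R) : measurable_fun setT f -> (forall t, 0 <= f t) -> 0 <= c ->
    (\int[Q]_t (c * f t)%:E = c%:E * \int[Q]_t (f t)%:E)%E.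
  move=> mf f0 c0; under eq_integral do rewrite EFinM.
  rewrite ge0_integralZl//; try by [exact/measurable_EFinP|move=> t _; rewrite lee_fin].
have intC (c : R) : (\int[Q]_t c%:E = c%:E)%E.
  by rewrite integral_cst// (indep_setT iX) mule1.
have k0' : 0 <= k^-1 by rewrite invr_ge0 ltW.
have l0' : 0 <= l^-1 by rewrite invr_ge0 ltW.
have h0' : 0 <= h^-1 by rewrite invr_ge0 ltW.
have E1ge0 t : 0 <= E1 t by exact: expR_ge0.
have E2ge0 t : 0 <= E2 t by exact: expR_ge0.
have mIA : measurable_fun setT (\1_A : T -> R) by exact: measurable_indic.
have IAge0 t : 0 <= \1_A t :> R by rewrite indicE.
have lhsE : (\int[Q]_t (lhs t)%:E = (x * fine (Q A) + c1)%:E)%E.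
  rewrite intD//; [|exact: measurable_funM|by move=> t; rewrite mulr_ge0].
  by rewrite intC intZ// integral_indic// setIT EFinD (EFinM x) fineK.
have rhsE : (\int[Q]_t (rhs t)%:E <= (M + (k^-1 * (n.+1%:R * ((1 - w) / (1 - w + k))
    + m.+1%:R * (w / (w + k))) + (l^-1 * bH + h^-1 * bV)))%:E)%E.
  have mS : measurable_fun setT (fun t => S1 t + S2 t) by exact: measurable_funD.
  have mE1l : measurable_fun setT (fun t => l^-1 * E1 t) by exact: measurable_funM.
  have mE2h : measurable_fun setT (fun t => h^-1 * E2 t) by exact: measurable_funM.
  have mE : measurable_fun setT (fun t => l^-1 * E1 t + h^-1 * E2 t).
    exact: measurable_funD.
  have mkS : measurable_fun setT (fun t => k^-1 * (S1 t + S2 t)) by exact: measurable_funM.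
  have E1l t : 0 <= l^-1 * E1 t by rewrite mulr_ge0.
  have E2h t : 0 <= h^-1 * E2 t by rewrite mulr_ge0.
  have Sge0 t : 0 <= S1 t + S2 t by rewrite addr_ge0.
  have kS t : 0 <= k^-1 * (S1 t + S2 t) by rewrite mulr_ge0.
  have Ege0 t : 0 <= l^-1 * E1 t + h^-1 * E2 t by rewrite addr_ge0.
  rewrite intD//; [|exact: measurable_funD|by move=> t; rewrite addr_ge0].
  rewrite intC intD// intZ// intD// S1int S2int [X in (_ + (_ + X))%E]intD//.
  rewrite [X in (_ + (_ + (X + _)))%E]intZ// [X in (_ + (_ + (_ + X)))%E]intZ//.
  rewrite -!EFinD -EFinM !EFinD !leeD2l//.
  by apply: leeD; rewrite EFinM lee_wpmul2l// lee_fin.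
have := le_trans _ rhsE => /(_ (\int[Q]_t (lhs t)%:E)%E).
rewrite lhsE lee_fin => /(_ _) H.
have {H} : x * fine (Q A) + c1 <= M + (k^-1 * (n.+1%:R * ((1 - w) / (1 - w + k))
    + m.+1%:R * (w / (w + k))) + (l^-1 * bH + h^-1 * bV)).
  apply: H; rewrite -lhsE; apply: ge0_le_integral => //.
  - by move=> t _; rewrite lee_fin addr_ge0// mulr_ge0.
  - by apply/measurable_EFinP; apply: measurable_funD => //; exact: measurable_funM.
  - apply/measurable_EFinP; apply: measurable_funD => //; apply: measurable_funD.
      by apply: measurable_funM => //; exact: measurable_funD.
    by apply: measurable_funD; exact: measurable_funM.
  - by move=> t _; rewrite lee_fin.
have splitE (u : R) : 0 < u -> (u + k)^-1 = k^-1 - k^-1 * (u / (u + k)).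
  move=> u0; have uk : u + k != 0 by rewrite gt_eqF//; lra.
  by field; rewrite uk gt_eqF.
have := splitE _ w1'; have := splitE _ w0; rewrite -/A /c1.
move: (w + k)^-1 (1 - w + k)^-1 k^-1 (fine (Q A)) => c b a qA cE bE.
have : m.+1%:R * (a * (w * c)) = m.+1%:R * (a - c) by congr (_ * _); lra.
have : n.+1%:R * (a * ((1 - w) * b)) = n.+1%:R * (a - b) by congr (_ * _); lra.
by move: (l^-1) (h^-1) => l' h'; lra.
Qed.

(** The limit [k] to 0 of [stationary_bound_aux], where the mean of the boundary
    increments cancels [M] exactly. *)
Lemma stationary_bound Q X (w x l h bH bV : R) m n
    (M := m.+1%:R / w + n.+1%:R / (1 - w)) :
  0 < w -> w < 1 -> 0 < l -> 0 < h -> 0 <= x ->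
  independent_exponentials Q X (boundary_rate w (1 - w)) (strip n.+1) ->
  (forall t, X (0%N, 0%N) t = 0) ->
  (\int[Q]_t (expR (l * (hor_lpt X m n.+1 t - M)))%:E <= bH%:E)%E ->
  (\int[Q]_t (expR (h * (ver_lpt X m.+1 n t - M + x)))%:E <= bV%:E)%E ->
  x * fine (Q [set t | hor_lpt X m n.+1 t < M - x]) <= bH / l + bV / h.
Proof.
move=> w0 w1 l0 h0 x0 iX X0 HE VE.
have w1' : 0 < 1 - w by lra.
pose C := m.+1%:R / w ^+ 2 + n.+1%:R / (1 - w) ^+ 2.
have C0 : 0 < C by rewrite /C addr_gt0// divr_gt0// exprn_gt0.
apply/ler_addgt0Pr => e e0.
have k0 : 0 < e / C by rewrite divr_gt0.
have := stationary_bound_aux w0 w1 l0 h0 x0 k0 iX X0 HE VE.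
set k := e / C in k0 *.
have diff (u c : R) : 0 < u -> 0 <= c -> c / u - c / (u + k) <= k * (c / u ^+ 2).
  move=> u0 c0; have uk : 0 < u + k by lra.
  have -> : c / u - c / (u + k) = k * (c / (u * (u + k))).
    by field; rewrite !gt_eqF.
  rewrite ler_pM2l// ler_wpM2l// lef_pV2 ?posrE ?exprn_gt0 ?mulr_gt0//.
  by rewrite expr2 ler_pM2l//; lra.
have := diff w m.+1%:R w0 (ler0n _ _); have := diff (1 - w) n.+1%:R w1' (ler0n _ _).
have kC : k * C = e by rewrite /k divfK// gt_eqF.
move: kC; rewrite /C mulrDr /M; lra.
Qed.

End lower_tail.

Section lower_tail_exponents.
Context d (T : measurableType d) (R : realType).
Implicit Types (Q : {measure set T -> \bar R}) (X : nat * nat -> T -> R).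

Lemma integral_expR_shift Q (f : T -> R) (l c B b : R) :
  measurable_fun setT f ->
  (\int[Q]_t (expR (l * f t))%:E <= B%:E)%E -> expR (l * c) * B <= b ->
  (\int[Q]_t (expR (l * (f t + c)))%:E <= b%:E)%E.
Proof.
move=> mf fB Bb.
under eq_integral do rewrite mulrDr expRD mulrC EFinM.
rewrite ge0_integralZl// ?lee_fin ?expR_ge0//; last first.
  by apply/measurable_EFinP; apply: measurableT_comp => //; exact: measurable_funM.
apply: (@le_trans _ _ (expR (l * c) * B)%:E); last by rewrite lee_fin.
by rewrite EFinM lee_wpmul2l// lee_fin expR_ge0.
Qed.

(** The exponent is l times the mean, minus l^2 / 2 times the derivative of the
    mean, plus a cubic remainder.  It serves the horizontal time with (u, v) = (w, 1 - w), and the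
    vertical one with the two rates exchanged, which flips the sign of the quadratic
    term. *)
Lemma mgf_exponent (u v l : R) m n : 0 < u -> 0 < v -> 0 < l -> l <= u / 2 ->
  (u / (u - l)) ^+ m * ((v + l) / v) ^+ n <=
  expR (l * (m%:R / u + n%:R / v) + l ^+ 2 / 2 * (m%:R / u ^+ 2 - n%:R / v ^+ 2)
        + l ^+ 3 * (m%:R / u ^+ 3 + n%:R / v ^+ 3)).
Proof.
move=> u0 v0 l0 lu.
have un : u != 0 by rewrite gt_eqF.
have vn : v != 0 by rewrite gt_eqF.
have uln : u - l != 0 by rewrite gt_eqF//; lra.
have -> : u / (u - l) = (1 - l / u)^-1.
  by rewrite -[1](divff un) -mulrBl invf_div.
have -> : (v + l) / v = 1 + l / v by rewrite mulrDl divff.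
have y0 : 0 <= l / u by rewrite divr_ge0 ?ltW.
have y1 : l / u <= 2^-1 by rewrite ler_pdivrMr// mulrC.
have y'0 : 0 <= l / v by rewrite divr_ge0 ?ltW.
apply: le_trans (ler_pM _ _ (inv1B_le_exp m y0 y1) (exp1D_le_exp n y'0)) _.
- by rewrite exprn_ge0// invr_ge0; lra.
- by rewrite exprn_ge0//; lra.
rewrite -expRD ler_expR le_eqVlt; apply/orP; left; apply/eqP.
by field; rewrite un vn.
Qed.

(** Here [a] is minus the derivative of the mean function at [w]; it is positive
    below [zeta], and this makes the quadratic term of the vertical contribution
    negative. *)
Lemma hor_lower_tail Q X (w x l h : R) m n (M := m.+1%:R / w + n.+1%:R / (1 - w))
    (a := m.+1%:R / w ^+ 2 - n.+1%:R / (1 - w) ^+ 2)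
    (b := m.+1%:R / w ^+ 3 + n.+1%:R / (1 - w) ^+ 3) :
  0 < w -> w < 1 -> 0 < l -> l <= w / 2 -> 0 < h -> h <= (1 - w) / 2 -> 0 <= x ->
  independent_exponentials Q X (boundary_rate w (1 - w)) (strip n.+1) ->
  (forall t, X (0%N, 0%N) t = 0) ->
  x * fine (Q [set t | hor_lpt X m n.+1 t < M - x]) <=
    expR (l ^+ 2 / 2 * a + l ^+ 3 * b) / l +
    expR (- (h ^+ 2 / 2 * a) + h ^+ 3 * b + h * x) / h.
Proof.
move=> w0 w1 l0 lw h0 hw x0 iX X0.
have w1' : 0 < 1 - w by lra.
apply: (stationary_bound w0 w1 l0 h0 x0 iX X0).
  have lw' : l < w by lra.
  apply: integral_expR_shift (mgf_hor m l0 lw' w1 w1' iX X0) _.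
    exact: measurable_hor_lpt iX.
  have -> : 1 - (w - l) = 1 - w + l by ring.
  apply: le_trans (ler_wpM2l _ (mgf_exponent _ _ w0 w1' l0 lw)) _; first exact: expR_ge0.
  by rewrite -expRD ler_expR /a /b /M; lra.
have hw' : h < 1 - w by lra.
under eq_integral do rewrite -addrA.
apply: integral_expR_shift (mgf_ver m.+1 w0 h0 hw' iX X0) _.
  exact: measurable_ver_lpt iX.
have -> : 1 - (w + h) = 1 - w - h by ring.
rewrite [X in _ * X]mulrC.
apply: le_trans (ler_wpM2l _ (mgf_exponent _ _ w1' w0 h0 hw)) _; first exact: expR_ge0.
rewrite -expRD ler_expR /a /b /M; lra.
Qed.

End lower_tail_exponents.

(** * Change of measure on the first columns *)

Section change_of_measure.
Context d (T : measurableType d) (R : realType).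
Implicit Types (Q P : {measure set T -> \bar R}) (X : nat * nat -> T -> R).

Definition nonorigin : pred (nat * nat) := fun p => p != (0%N, 0%N).

(** The vertical axis is kept, to serve as the vertical boundary of the remaining
    rectangle. *)
Definition skip_columns k (p : nat * nat) : nat * nat :=
  if p.1 == 0%N then p else (k + p.1, p.2)%N.

Definition south_axis k : seq (nat * nat) := [seq (i, 0%N) | i <- iota 1 k].

(** The tilted weights all lie in the columns that are skipped, so the remaining
    system is stationary once its vertical boundary is rescaled. *)
Lemma skip_columns_indep Q X (w r w' : R) k n : 0 < r -> w < 1 ->
  independent_exponentials Q X
    (fun p => if p \in south_axis k then w' else boundary_rate w r p) nonorigin ->
  (forall t, X (0%N, 0%N) t = 0) ->
  exists2 X', independent_exponentials Q X' (boundary_rate w (1 - w)) (strip n) /\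
     (forall t, X' (0%N, 0%N) t = 0) &
    forall m t, \sum_(p <- south_axis k) X p t + hor_lpt X' m n t <=
      hor_lpt X (k + m) n t.
Proof.
move=> r0 w1 iX X0.
have w1' : 0 < 1 - w by rewrite subr_gt0.
have iS : independent_exponentials Q (X \o skip_columns k) (boundary_rate w r) (strip n).
  have := @indep_reindex _ _ _ _ _ _ _ _ _ (strip n) (skip_columns k)
    (fun p => (p.1 - k, p.2)%N) iX.
  move=> /(_ _)/indep_ext; apply=> [[a b] /andP[ab _]|[a b] Dab].
    rewrite /skip_columns/=; case: eqP => [a0|/eqP a0]; last first.
      by rewrite /nonorigin/= addKn xpair_eqE addn_eq0 (negbTE a0) andbF.
    by rewrite /nonorigin ab; split => //; rewrite a0.
  split => //; rewrite /=; have -> : (skip_columns k (a, b) \in south_axis k) = false.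
    apply/negP => /mapP[i]; rewrite mem_iota add1n ltnS => /andP[i0 ik].
    rewrite /skip_columns/=; case: eqP => [a0 [ia _]|/eqP a0 [ia _]].
      by move: i0; rewrite -ia a0.
    by move: ik; rewrite -ia -{2}(addn0 k) leq_add2l leqn0 (negbTE a0).
  rewrite /boundary_rate /skip_columns /=; case: (a) => [//|a'] /=.
  by rewrite addnS.
exists (rescale 1 (r / (1 - w)) (X \o skip_columns k)).
  split; last by move=> t; apply: rescale_origin; rewrite /= /skip_columns/= X0.
  have := rescale_indep ltr01 (divr_gt0 r0 w1') iS.
  by rewrite divr1 invf_div mulrCA divff ?mulr1 ?gt_eqF.
move=> m t; rewrite hor_rescale.
apply: le_trans (lprec_shift _ k m n); rewrite lerD//.
  rewrite big_map -[iota 1 k](map_id) /index_iota subn0.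
  by rewrite -[1%N]addn0 iotaDl map_id big_map.
rewrite le_eqVlt; apply/orP; left; apply/eqP; apply: eq_lprec => p.
by rewrite /shift_weights /skip_columns/= !add0n addnCA.
Qed.

Lemma measurable_lt_set (f : T -> R) c : measurable_fun setT f ->
  measurable [set t | (f t < c)%R].
Proof.
move=> mf; rewrite (_ : mkset _ = f @^-1` `]-oo, c[%classic); last first.
  by rewrite predeqE => t /=; rewrite in_itv/=.
by rewrite -[X in measurable X]setTI; exact: mf.
Qed.

Lemma measurable_ge_set (f : T -> R) c : measurable_fun setT f ->
  measurable [set t | c <= f t].
Proof.
move=> mf; rewrite (_ : mkset _ = f @^-1` `[c, +oo[%classic); last first.
  by rewrite predeqE => t /=; rewrite in_itv/= andbT.
by rewrite -[X in measurable X]setTI; exact: mf.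
Qed.

Lemma chernoff_lower Q (f : T -> R) (l c B b : R) : measurable_fun setT f -> 0 < l ->
  (\int[Q]_t (expR (- l * f t))%:E = B%:E)%E -> expR (l * c) * B <= b ->
  (Q [set t | (f t < c)%R] <= b%:E)%E.
Proof.
move=> mf l0 fB Bb.
have mA := measurable_lt_set c mf.
apply: (@le_trans _ _ (\int[Q]_t (expR (- l * (f t + - c)))%:E)%E); last first.
  by apply: integral_expR_shift => //; [rewrite fB|rewrite mulrNN].
rewrite -(setIT [set t | _]) -integral_indic//.
apply: ge0_le_integral => //.
- by apply/measurable_EFinP; exact: measurable_indic.
- apply/measurable_EFinP; apply: measurableT_comp => //; apply: measurable_funM => //.
  exact: measurable_funD.
move=> t _; rewrite lee_fin indicE.
case: (boolP (t \in _)) => [/set_mem/= fc|_]; last exact: expR_ge0.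
by rewrite -expR0 ler_expR mulNr -mulrN mulr_ge0 ?(ltW l0)//; lra.
Qed.

(** Under the measure [Q] that lowers the first [k] rates to [w - th], the event
    has probability at least 1/2 by the union bound.  It is transported back to [P] by
    tilt * 1_A <= H 1_A + tilt^2 / (4 H), an elementary form of Cauchy-Schwarz in
    which [H] is the second moment of the density. *)
Lemma upper_tail_lower_bound P X (w r th l c1 c2 : R) k m n
    (H := ((w - th) ^+ 2 / (w * (w - 2 * th))) ^+ k) :
  independent_exponentials P X (boundary_rate w r) nonorigin ->
  (forall t, X (0%N, 0%N) t = 0) ->
  0 < r -> w < 1 -> 0 < th -> 2 * th < w -> 0 < l ->
  (forall Q X', independent_exponentials Q X' (boundary_rate w (1 - w)) (strip n) ->
    (forall t, X' (0%N, 0%N) t = 0) ->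
    (Q [set t | (hor_lpt X' m n t < c1)%R] <= (4^-1)%:E)%E) ->
  expR (l * c2) * ((w - th) / (w - th + l)) ^+ k <= 4^-1 ->
  (((4 * H)^-1)%:E <= P [set t | (c1 + c2 <= hor_lpt X (k + m) n t)%R])%E.
Proof.
move=> iX X0 r0 w1 th0 thw l0 low Sbound.
have w0 : 0 < w by lra.
have wth0 : 0 < w - th by lra.
have w2th0 : 0 < w - 2 * th by lra.
have H0 : 0 < H by rewrite exprn_gt0// divr_gt0 ?exprn_gt0// mulr_gt0.
pose L := south_axis k.
have uL : uniq L by rewrite map_inj_uniq ?iota_uniq// => i j [].
have inL p : p \in L -> exists2 i, (0 < i)%N & p = (i, 0%N).
  by move=> /mapP[i]; rewrite mem_iota => /andP[i0 _] ->; exists i.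
have DL : all nonorigin L.
  by apply/allP => p /inL[i i0 ->]; rewrite /nonorigin xpair_eqE/= andbT -lt0n.
have sL : size L = k by rewrite size_map size_iota.
have rL p : p \in L -> boundary_rate w r p = w by move=> /inL[i _ ->].
have [Q [iQ Qint]] := tilt_exponentials (rate' := fun=> w - th) iX uL DL (fun _ _ => wth0).
pose S t := \sum_(p <- L) X p t.
have mX p : p \in L -> measurable_fun setT (X p).
  by move=> pL; apply: (indep_measurable iX); exact: (allP DL).
have mS : measurable_fun setT S by exact: measurable_sum_seq.
have QS : (Q [set t | (S t < c2)%R] <= (4^-1)%:E)%E.
  apply: (chernoff_lower mS l0 _ Sbound).
  rewrite /S (laplace_sum iQ)//; last by move=> p pL; rewrite pL; lra.
  congr EFin; rewrite (eq_big_seq (fun=> (w - th) / (w - th + l))) ?prod_const_seq ?sL//.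
  by move=> p pL; rewrite pL opprK.
have [X' [iX' X'0] SX'] := skip_columns_indep n r0 w1 iQ X0.
have QX' := low _ _ iX' X'0.
have mX' : measurable_fun setT (hor_lpt X' m n) by exact: measurable_hor_lpt iX'.
have iXs : independent_exponentials P X (boundary_rate w r) (strip n).
  by apply: (indep_ext iX) => p /andP[p0 _].
have mG : measurable_fun setT (hor_lpt X (k + m) n) by exact: measurable_hor_lpt iXs.
pose A := [set t | (c1 + c2 <= hor_lpt X (k + m) n t)%R].
have mA : measurable A by exact: measurable_ge_set.
have QA : ((2^-1)%:E <= Q A)%E.
  have : (1%E <= Q A + (Q [set t | (S t < c2)%R] + Q [set t | (hor_lpt X' m n t < c1)%R]))%E.
    rewrite -(indep_setT iQ).
    have mS2 := measurable_lt_set c2 mS; have mX2 := measurable_lt_set c1 mX'.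
    apply: (@le_trans _ _ (Q (A `|` ([set t | (S t < c2)%R] `|`
      [set t | (hor_lpt X' m n t < c1)%R])))).
      apply: le_measure; rewrite ?inE//; first by do 2 apply: measurableU => //.
      move=> t _; have [Sc|Sc] := ltP (S t) c2; first by right; left.
      have [Xc|Xc] := ltP (hor_lpt X' m n t) c1; first by right; right.
      by left; rewrite /A/=; apply: le_trans (SX' m t); rewrite addrC lerD.
    apply: (le_trans (measureU2 _ mA (measurableU _ _ mS2 mX2))).
    by rewrite leeD2l// measureU2.
  move=> h; have {}h := le_trans h (leeD2l _ (leeD QS QX')).
  rewrite -(@leeD2rE _ (2^-1)%:E)//.
  have e : ((4^-1)%:E + (4^-1)%:E = (2^-1)%:E :> \bar R)%E.
    by rewrite -EFinD; congr EFin; lra.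
  rewrite e in h; apply: le_trans h.
  by rewrite -EFinD lee_fin; lra.
pose tl := tilt X (boundary_rate w r) (fun=> w - th) L.
have mtl : measurable_fun setT tl by exact: measurable_tilt.
have tl0 t : 0 <= tl t by apply: tilt_ge0 => // p /rL ->.
have tlE t : tl t = ((w - th) / w) ^+ k * expR (th * S t).
  rewrite /tl /tilt (eq_big_seq (fun p => (w - th) / w * expR (th * X p t))).
    by rewrite big_split/= prod_const_seq sL /S mulr_sumr expR_sum.
  by move=> p /rL ->; rewrite subKr.
have tl2 : (\int[P]_t (tl t ^+ 2)%:E = H%:E)%E.
  transitivity (\int[P]_t ((((w - th) / w) ^+ k ^+ 2)%:E * (expR (2 * th * S t))%:E))%E.
    apply: eq_integral => t _; rewrite tlE exprMn -EFinM; congr (_ * _)%:E.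
    by rewrite expr2 -expRD; congr expR; ring.
  rewrite ge0_integralZl// ?lee_fin ?sqr_ge0//; last first.
    by apply/measurable_EFinP; apply: measurableT_comp => //; exact: measurable_funM.
  rewrite /S (laplace_sum iX)//; last by move=> p /rL ->.
  rewrite (eq_big_seq (fun=> w / (w - 2 * th))); last by move=> p /rL ->.
  rewrite prod_const_seq sL -EFinM; congr EFin.
  rewrite -exprM mulnC exprM -exprMn /H; congr (_ ^+ _).
  by field; rewrite !gt_eqF.
have QAint : (Q A = \int[P]_t (tl t * \1_A t)%:E)%E.
  rewrite -(setIT A) -integral_indic// Qint//.
  - by rewrite setIT.
  - by apply/measurable_EFinP; exact: measurable_indic.
have PAfin : P A \is a fin_num.
  rewrite ge0_fin_numE// (@le_lt_trans _ _ 1%E) ?ltry//.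
  by rewrite -(indep_setT iX) le_measure// inE.
have : (Q A <= (H * fine (P A) + 4^-1)%:E)%E.
  have mI : measurable_fun setT (\1_A : T -> R) by exact: measurable_indic.
  have c0 : 0 <= (4 * H)^-1 by rewrite invr_ge0 mulr_ge0 ?ltW.
  apply: (@le_trans _ _ (\int[P]_t ((H * \1_A t)%:E + ((4 * H)^-1 * tl t ^+ 2)%:E))%E).
    rewrite QAint; apply: ge0_le_integral => //.
    - by move=> t _; rewrite lee_fin mulr_ge0.
    - by apply/measurable_EFinP; exact: measurable_funM.
    - apply/measurable_EFinP; apply: measurable_funD; first exact: measurable_funM.
      by apply: measurable_funM => //; exact: measurable_funX.
    move=> t _; rewrite -EFinD lee_fin indicE.
    (* equivalent to (tilt - 2 H)^2 >= 0 *)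
    have e : tl t * 1 <= H * 1 + (4 * H)^-1 * tl t ^+ 2.
      rewrite !mulr1 -subr_ge0.
      have -> : H + (4 * H)^-1 * tl t ^+ 2 - tl t = (4 * H)^-1 * (tl t - 2 * H) ^+ 2.
        by field; rewrite gt_eqF.
      by rewrite mulr_ge0// sqr_ge0.
    by case: (t \in A) => //; rewrite !mulr0 add0r mulr_ge0// sqr_ge0.
  rewrite ge0_integralD//;
    try by [move=> t _; rewrite lee_fin mulr_ge0 ?sqr_ge0// ltW
           |apply/measurable_EFinP; apply: measurable_funM => //; exact: measurable_funX].
  under eq_integral do rewrite EFinM.
  rewrite ge0_integralZl// ?lee_fin ?(ltW H0)//; last exact/measurable_EFinP.
  rewrite integral_indic// setIT.
  under eq_integral do rewrite EFinM.
  rewrite ge0_integralZl//;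
    try by [move=> t _; rewrite lee_fin sqr_ge0|rewrite lee_fin
           |apply/measurable_EFinP; exact: measurable_funX].
  rewrite tl2 EFinD EFinM fineK// -EFinM.
  by have -> : (4 * H)^-1 * H = 4^-1 by field; rewrite gt_eqF.
move=> /(le_trans QA); rewrite lee_fin -/A -[P A]fineK// lee_fin invfM => h.
rewrite ler_pdivrMr//; lra.
Qed.

End change_of_measure.

(** * Choice of the parameters *)

Section parameters.
Context {R : realType}.
Implicit Types m n w s : R.

(** With sigma = (sqrt m + sqrt n)^2, which lies between N and 2 N, one has
    m = sigma z^2 and n = sigma (1 - z)^2, so that [a] factors as sigma (z - w) times a
    quantity bounded above and below. *)
Lemma slope_bounds m n w e0 (z := Num.sqrt m / (Num.sqrt m + Num.sqrt n))
    (a := m / w ^+ 2 - n / (1 - w) ^+ 2) (N := m + n) :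
  0 < m -> 0 < n -> 0 < e0 -> e0 <= w -> e0 <= 1 - z -> w < z ->
  4 * (N * (z - w)) <= a <= 4 / e0 ^+ 3 * (N * (z - w)).
Proof.
move=> m0 n0 e00 ew ez wz.
have sm0 : 0 < Num.sqrt m by rewrite sqrtr_gt0.
have sn0 : 0 < Num.sqrt n by rewrite sqrtr_gt0.
have smE : Num.sqrt m ^+ 2 = m by rewrite sqr_sqrtr// ltW.
have snE : Num.sqrt n ^+ 2 = n by rewrite sqr_sqrtr// ltW.
have s0 : 0 < Num.sqrt m + Num.sqrt n by rewrite addr_gt0.
pose sg := (Num.sqrt m + Num.sqrt n) ^+ 2.
have mE : m = sg * z ^+ 2.
  by rewrite /sg /z expr_div_n mulrC divfK ?smE// expf_neq0// gt_eqF.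
have nE : n = sg * (1 - z) ^+ 2.
  have -> : 1 - z = Num.sqrt n / (Num.sqrt m + Num.sqrt n).
    by rewrite /z; field; rewrite gt_eqF.
  by rewrite /sg expr_div_n mulrC divfK ?snE// expf_neq0// gt_eqF.
have Nsg : N <= sg.
  by rewrite /N /sg sqrrD smE snE; have := mulr_gt0 sm0 sn0; lra.
have sgN : sg <= 2 * N.
  rewrite /N /sg sqrrD smE snE; have := sqr_ge0 (Num.sqrt m - Num.sqrt n).
  by rewrite sqrrB smE snE; lra.
have N0 : 0 < N by rewrite addr_gt0.
have w0 : 0 < w by lra.
have w1 : 0 < 1 - w by lra.
have z0 : 0 < z by lra.
have z1 : z < 1 by lra.
have aE : a = sg * (z - w) * ((z / w + (1 - z) / (1 - w)) / (w * (1 - w))).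
  rewrite /a [in LHS]mE [in LHS]nE; field.
  by rewrite !gt_eqF.
have ww0 : 0 < w * (1 - w) by exact: mulr_gt0.
have Dl0 : 0 < z - w by lra.
have zw1 : 1 <= z / w by rewrite ler_pdivlMr//; lra.
have zw2 : 0 < (1 - z) / (1 - w) by rewrite divr_gt0//; lra.
set f := (_ / (w * (1 - w))) in aE.
have e01 : e0 <= 1 by lra.
have f4 : 4 <= f.
  rewrite /f ler_pdivlMr//; have := sqr_ge0 (2 * w - 1); rewrite expr2; nra.
have fe : f <= 2 / e0 ^+ 3.
  have -> : 2 / e0 ^+ 3 = (1 / e0 + 1 / e0) * (1 / e0 ^+ 2).
    by field; rewrite gt_eqF.
  apply: ler_pM.
  - by rewrite addr_ge0// ltW// (lt_le_trans ltr01).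
  - by rewrite invr_ge0 ltW.
  - apply: lerD.
      rewrite ler_pdivrMr//; have : 1 <= 1 / e0 * w.
        by rewrite div1r mulrC ler_pdivlMr// mul1r.
      lra.
    have : (1 - z) / (1 - w) <= 1 by rewrite ler_pdivrMr//; lra.
    have : 1 <= 1 / e0 by rewrite ler_pdivlMr// mul1r.
    lra.
  - rewrite div1r lef_pV2 ?posrE ?exprn_gt0// expr2.
    by apply: ler_pM; lra.
rewrite aE; apply/andP; split.
  by rewrite [leLHS]mulrC; apply: ler_pM; rewrite ?ler_pM2r// mulr_ge0 ?ltW.
have -> : 4 / e0 ^+ 3 * (N * (z - w)) = (2 * N * (z - w)) * (2 / e0 ^+ 3) by ring.
apply: ler_pM => //; last by rewrite ler_pM2r.
  by rewrite mulr_ge0//; lra.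
lra.
Qed.

(** The exponential parameters are 1 / D1 for the horizontal time and eta Delta
    for the vertical one.  The value of [eta] makes the cubic term at most half of
    the quadratic one; the other half beats the linear term as soon as
    eta sqrt (N Delta^3) >= 2 s. *)
Lemma lower_tail_parameters N Dl e0 a b s
    (eta := e0 ^+ 3 / 2) (D1 := Num.sqrt (N * Dl)) :
  0 < e0 -> 0 < N -> 0 < Dl ->
  4 * (expR (2 / e0 ^+ 3 + 1 / e0 ^+ 3) + 1) <= s ->
  2 * (N * Dl) <= a -> a <= 4 / e0 ^+ 3 * (N * Dl) -> 0 <= b -> b <= N / e0 ^+ 3 ->
  1 <= N * Dl ^+ 3 -> (2 * s / eta) ^+ 2 <= N * Dl ^+ 3 ->
  expR (D1^-1 ^+ 2 / 2 * a + D1^-1 ^+ 3 * b) / D1^-1 +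
  expR (- ((eta * Dl) ^+ 2 / 2 * a) + (eta * Dl) ^+ 3 * b + (eta * Dl) * (s * D1)) /
    (eta * Dl) <= s * D1 / 4.
Proof.
move=> e00 N0 Dl0 sE aL aU b0 bU K1 K2.
have A0 : 0 < N * Dl by exact: mulr_gt0.
have D10 : 0 < D1 by rewrite sqrtr_gt0.
have D1E : D1 ^+ 2 = N * Dl by rewrite sqr_sqrtr// ltW.
have eta0 : 0 < eta by rewrite divr_gt0// exprn_gt0.
pose u := Dl * D1.
have u0 : 0 < u by exact: mulr_gt0.
have uE : u ^+ 2 = N * Dl ^+ 3 by rewrite exprMn D1E; ring.
have s4 : 4 <= s by apply: le_trans sE; have := expR_ge0 (2 / e0 ^+ 3 + 1 / e0 ^+ 3); lra.
have u1 : 1 <= u by rewrite -(@ler_pXn2r _ 2)// ?nnegrE ?(ltW u0)// expr1n uE.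
have u2 : 2 * s / eta <= u.
  rewrite -(@ler_pXn2r _ 2)// ?nnegrE ?uE//; last exact: ltW.
  by rewrite divr_ge0 ?ltW//; lra.
have us : 2 * s <= eta * u by rewrite (mulrC eta) -ler_pdivrMr.
have e3 : 0 < e0 ^+ 3 by exact: exprn_gt0.
have first : D1^-1 ^+ 2 / 2 * a + D1^-1 ^+ 3 * b <= 2 / e0 ^+ 3 + 1 / e0 ^+ 3.
  apply: lerD.
    rewrite exprVn D1E.
    have -> : (N * Dl)^-1 / 2 * a = a / (2 * (N * Dl)) by field; rewrite !gt_eqF.
    rewrite ler_pdivrMr ?mulr_gt0//; apply: (le_trans aU).
    by rewrite le_eqVlt; apply/orP; left; apply/eqP; ring.
  rewrite exprVn [leLHS]mulrC ler_pdivrMr ?exprn_gt0//.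
  apply: (le_trans bU); rewrite mul1r mulrC ler_pM2l ?invr_gt0//.
  have -> : D1 ^+ 3 = N * u by rewrite /u exprSr D1E; ring.
  by rewrite ler_pMr.
have second : - ((eta * Dl) ^+ 2 / 2 * a) + (eta * Dl) ^+ 3 * b +
    (eta * Dl) * (s * D1) <= 0.
  have h1 : eta ^+ 2 * u ^+ 2 <= (eta * Dl) ^+ 2 / 2 * a.
    have -> : eta ^+ 2 * u ^+ 2 = (eta * Dl) ^+ 2 / 2 * (2 * (N * Dl)).
      by rewrite uE; field.
    by rewrite ler_pM2l// divr_gt0// exprn_gt0// mulr_gt0.
  have h2 : (eta * Dl) ^+ 3 * b <= eta ^+ 2 * u ^+ 2 / 2.
    have -> : eta ^+ 2 * u ^+ 2 / 2 = (eta * Dl) ^+ 3 * (N / e0 ^+ 3).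
      by rewrite uE /eta; field; rewrite gt_eqF.
    by rewrite ler_pM2l// exprn_gt0// mulr_gt0.
  have h3 : (eta * Dl) * (s * D1) = s * (eta * u) by rewrite /u; ring.
  rewrite h3; have : 0 <= (eta * u) * (eta * u - 2 * s).
    by rewrite mulr_ge0// ?subr_ge0// mulr_ge0 ?ltW.
  move: h1 h2; rewrite -exprMn expr2; lra.
have hD : (eta * Dl)^-1 <= D1.
  rewrite -[leLHS]mul1r ler_pdivrMr ?mulr_gt0// mulrC -mulrA -/u; lra.
have e1 : expR (D1^-1 ^+ 2 / 2 * a + D1^-1 ^+ 3 * b) / D1^-1 <=
    expR (2 / e0 ^+ 3 + 1 / e0 ^+ 3) * D1.
  by rewrite invrK ler_pM2r// ler_expR.
have e2 : expR (- ((eta * Dl) ^+ 2 / 2 * a) + (eta * Dl) ^+ 3 * b +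
    (eta * Dl) * (s * D1)) / (eta * Dl) <= D1.
  apply: le_trans hD; rewrite -[leRHS]mul1r ler_pM2r ?invr_gt0 ?mulr_gt0//.
  by rewrite -[leRHS]expR0 ler_expR.
apply: (le_trans (lerD e1 e2)).
have -> : s * D1 / 4 = (s / 4) * D1 by ring.
by rewrite -[X in _ + X]mul1r -mulrDl ler_pM2r//; lra.
Qed.

(** Multiplied by the new rate w - th < 1, the gain k / (w - th) - k / w in the mean
    of the sum of [k] weights is k th / w, and three of its standard deviations are
    3 sqrt k.  [th] is chosen so that the gain covers these, D, and the loss s sqrt A of
    the lower tail estimate. *)
Lemma tilt_parameters A k q w e0 s (D := Num.sqrt (q * A))
    (C2 := 1 + s + 3 * Num.sqrt (4 / e0 ^+ 3)) (th := C2 * w * D / k) :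
  0 < e0 -> e0 <= w -> w < 1 -> 0 < A -> 1 <= q -> 0 <= s ->
  e0 ^+ 2 * A <= k -> k <= 4 / e0 ^+ 3 * A ->
  (4 * C2 / e0 ^+ 2) ^+ 2 * q <= A ->
  [/\ 0 < th, 4 * th <= w,
      s * Num.sqrt A + D + 3 * Num.sqrt k <= k * th / w &
      k * (th ^+ 2 / (w * (w - 2 * th))) <= 2 * C2 ^+ 2 / e0 ^+ 2 * q].
Proof.
move=> e00 ew w1 A0 q1 s0 kL kU qA.
have w0 : 0 < w by lra.
have k0 : 0 < k by apply: lt_le_trans kL; rewrite mulr_gt0// exprn_gt0.
have q0 : 0 < q by lra.
have D0 : 0 < D by rewrite sqrtr_gt0 mulr_gt0.
have DE : D ^+ 2 = q * A by rewrite sqr_sqrtr// mulr_ge0 ?ltW.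
have Ca0 : 0 < 4 / e0 ^+ 3 by rewrite divr_gt0// exprn_gt0.
have C20 : 1 <= C2.
  by rewrite /C2 -addrA lerDl addr_ge0// mulr_ge0// sqrtr_ge0.
have C20' : 0 < C2 by lra.
have th0 : 0 < th by rewrite divr_gt0// !mulr_gt0.
have sAD : Num.sqrt A <= D by apply: ler_wsqrtr; rewrite ler_peMl// ltW.
have e2 : 0 < e0 ^+ 2 by exact: exprn_gt0.
have DA : 4 * C2 / e0 ^+ 2 * D <= A.
  rewrite -(@ler_pXn2r _ 2)// ?nnegrE ?(ltW A0)//; last first.
    by rewrite !mulr_ge0// ?invr_ge0 ltW.
  by rewrite exprMn DE expr2 mulrA ler_pM2r.
have th4 : 4 * th <= w.
  rewrite /th mulrA ler_pdivrMr//.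
  have -> : 4 * (C2 * w * D) = w * (4 * C2 * D) by ring.
  rewrite ler_pM2l//; apply: le_trans kL.
  by rewrite [leRHS]mulrC -ler_pdivrMr// mulrAC.
have kth : k * th / w = C2 * D by rewrite /th; field; rewrite !gt_eqF.
split => //.
- have sk : Num.sqrt k <= Num.sqrt (4 / e0 ^+ 3) * D.
    apply: (le_trans (ler_wsqrtr kU)); rewrite sqrtrM ?(ltW Ca0)//.
    by rewrite ler_wpM2l ?sqrtr_ge0.
  have ssAD : s * Num.sqrt A <= s * D by rewrite ler_wpM2l.
  by rewrite kth /C2; lra.
- have w2 : 0 < w - 2 * th by lra.
  have k2 : th ^+ 2 / (w * (w - 2 * th)) <= th ^+ 2 / (w * (w / 2)).
    rewrite ler_wpM2l ?sqr_ge0// lef_pV2 ?posrE ?mulr_gt0//.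
    by rewrite ler_pM2l//; lra.
  apply: (le_trans (ler_wpM2l (ltW k0) k2)).
  have -> : k * (th ^+ 2 / (w * (w / 2))) = 2 * C2 ^+ 2 * D ^+ 2 / k.
    by rewrite /th; field; rewrite !gt_eqF.
  rewrite DE ler_pdivrMr//.
  have -> : 2 * C2 ^+ 2 * (q * A) = 2 * C2 ^+ 2 / e0 ^+ 2 * q * (e0 ^+ 2 * A).
    by field; rewrite gt_eqF.
  rewrite ler_wpM2l// mulr_ge0 ?(ltW q0)// divr_ge0 ?sqr_ge0// mulr_ge0// sqr_ge0.
  by [].
Qed.
End parameters.

Section upper_tail.
Context {R : realType}.

Definition boundary_mean (w : R) m n : R := m.+1%:R / w + n.+1%:R / (1 - w).

(** (w - th)^2 = w (w - 2 th) + th^2. *)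
Lemma tilt_cost_le (w th B : R) k : 0 < w -> 0 < th -> 4 * th <= w ->
  k%:R * (th ^+ 2 / (w * (w - 2 * th))) <= B ->
  ((w - th) ^+ 2 / (w * (w - 2 * th))) ^+ k <= expR B.
Proof.
move=> w0 th0 th4 kB.
have w2 : 0 < w - 2 * th by lra.
have -> : (w - th) ^+ 2 / (w * (w - 2 * th)) = 1 + th ^+ 2 / (w * (w - 2 * th)).
  by field; rewrite !gt_eqF.
apply: (@le_trans _ _ (expR (k%:R * (th ^+ 2 / (w * (w - 2 * th)))))); last by rewrite ler_expR.
rewrite expRM_natl; apply: lerXn2r; rewrite ?nnegrE ?expR_ge0 ?expR_ge1Dx//.
by rewrite addr_ge0// divr_ge0 ?sqr_ge0// mulr_ge0 ?(ltW w0) ?(ltW w2).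
Qed.

(** A sum of [k] variables of law Exp(v) is below its mean by three standard
    deviations with probability at most exp (- 2) <= 1/4. *)
Lemma gamma_lower_chernoff (v c : R) k : 0 < v -> (0 < k)%N ->
  v * c <= k%:R - 3 * Num.sqrt k%:R ->
  expR (v / Num.sqrt k%:R * c) * (v / (v + v / Num.sqrt k%:R)) ^+ k <= 4^-1.
Proof.
move=> v0 k0 vc; set g := Num.sqrt k%:R in vc *.
have g0 : 0 < g by rewrite sqrtr_gt0 ltr0n.
have gE : g ^+ 2 = k%:R by rewrite sqr_sqrtr.
have g1 : 0 < g + 1 by lra.
have -> : v / (v + v / g) = 1 + - (g + 1)^-1.
  have vg0 : 0 < v * g + v by rewrite addr_gt0// mulr_gt0.
  by field; rewrite !gt_eqF.
have g10 : 0 <= 1 + - (g + 1)^-1.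
  by rewrite subr_ge0 invf_le1//; lra.
apply: (@le_trans _ _ (expR (v / g * c) * expR (k%:R * - (g + 1)^-1))).
  rewrite ler_wpM2l ?expR_ge0// expRM_natl.
  by apply: lerXn2r; rewrite ?nnegrE ?expR_ge0 ?expR_ge1Dx.
rewrite -expRD.
have e2 : v / g * c <= g - 3.
  have -> : v / g * c = (v * c) / g by field; rewrite gt_eqF.
  by rewrite ler_pdivrMr// mulrBl -expr2 gE.
have e3 : k%:R * - (g + 1)^-1 <= 1 - g.
  by rewrite mulrN lerNl opprB ler_pdivlMr// -gE; lra.
apply: (@le_trans _ _ (expR (- 2))); first by rewrite ler_expR; lra.
rewrite expRN lef_pV2 ?posrE ?expR_gt0//.
by apply: le_trans (expR_ge_quadratic _) => //; rewrite expr2; lra.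
Qed.

(** [k] is the integer part of w^2 a / 2, so that removing [k] columns at most halves the
    slope [a] of the mean at [w]: the remaining rectangle still has a slope of order
    N Delta, and [k] itself has that order. *)
Lemma hor_upper_tail (e0 : R) : 0 < e0 ->
  exists K C : R, [/\ 1 <= K, 0 < C & forall d (T : measurableType d)
    (P : {measure set T -> \bar R}) (X : nat * nat -> T -> R) (w r q : R) m n
    (z := Num.sqrt m.+1%:R / (Num.sqrt m.+1%:R + Num.sqrt n.+1%:R))
    (N := m.+1%:R + n.+1%:R : R),
    independent_exponentials P X (boundary_rate w r) nonorigin ->
    (forall t, X (0%N, 0%N) t = 0) -> 0 < r ->
    e0 <= w -> e0 <= 1 - z -> w < z -> 1 <= q -> K * q <= N * (z - w) ^+ 3 ->
    (((4 * expR (C * q))^-1)%:E <=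
      P [set t | (boundary_mean w m n + Num.sqrt (q * (N * (z - w))) <=
                  hor_lpt X m n.+1 t)%R])%E].
Proof.
move=> e00.
pose s : R := 4 * (expR (2 / e0 ^+ 3 + 1 / e0 ^+ 3) + 1).
pose eta := e0 ^+ 3 / 2.
pose C2 := 1 + s + 3 * Num.sqrt (4 / e0 ^+ 3).
have s0 : 0 < s by rewrite mulr_gt0// addr_gt0// expR_gt0.
have C20 : 0 < C2.
  by rewrite /C2; have := sqrtr_ge0 (4 / e0 ^+ 3); lra.
have e2 : 0 < e0 ^+ 2 by exact: exprn_gt0.
(* each summand is a lower bound for N Delta^3 used below *)
pose K := 1 + (2 * s / eta) ^+ 2 + (4 * C2 / e0 ^+ 2) ^+ 2 + 4 / e0 ^+ 2.
have p1 : 0 <= (2 * s / eta) ^+ 2 by exact: sqr_ge0.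
have p2 : 0 <= (4 * C2 / e0 ^+ 2) ^+ 2 by exact: sqr_ge0.
have p3 : 0 <= 4 / e0 ^+ 2 by rewrite divr_ge0// ltW.
exists K, (2 * C2 ^+ 2 / e0 ^+ 2); split.
- by rewrite /K; lra.
- by rewrite divr_gt0// mulr_gt0// exprn_gt0.
move=> d T P X w r q m n z N iX X0 r0 ew ez wz q1 Kq.
have w0 : 0 < w by lra.
have w1 : w < 1 by lra.
have w1' : 0 < 1 - w by lra.
have Dl0 : 0 < z - w by lra.
have N0 : 0 < N by rewrite addr_gt0.
set Dl := z - w in Dl0 Kq *; set A := N * Dl.
have A0 : 0 < A by exact: mulr_gt0.
have Dl1 : Dl <= 1 by rewrite /Dl; lra.
have KN : K <= N * Dl ^+ 3 by apply: le_trans Kq; rewrite ler_peMr//; rewrite /K; lra.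
have NA : N * Dl ^+ 3 <= A.
  by rewrite /A ler_pM2l// exprS ler_piMr ?(ltW Dl0)// exprn_ile1 ?(ltW Dl0).
have /andP[aL aU] := slope_bounds (ltr0Sn R m) (ltr0Sn R n) e00 ew ez wz.
rewrite -/N -/Dl -/A in aL aU.
set a := _ - _ in aL aU.
have a0 : 0 <= a by apply: le_trans aL; rewrite mulr_ge0// ltW.
have wa0 : 0 <= w ^+ 2 * a / 2 by rewrite divr_ge0// mulr_ge0 ?sqr_ge0.
pose k := Num.truncn (w ^+ 2 * a / 2).
have kle : k%:R <= w ^+ 2 * a / 2 by rewrite truncn_le.
have klt : w ^+ 2 * a / 2 < k.+1%:R by rewrite truncnS_gt.
have wam : w ^+ 2 * a <= m.+1%:R.
  have -> : w ^+ 2 * a = m.+1%:R - w ^+ 2 * (n.+1%:R / (1 - w) ^+ 2).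
    by rewrite /a; field; rewrite !gt_eqF.
  by rewrite lerBlDr lerDl mulr_ge0 ?sqr_ge0// divr_ge0 ?sqr_ge0.
have km : (k <= m)%N.
  by rewrite -ltnS -(ltr_nat R); have := ltr0Sn R m; lra.
have eA : 4 <= e0 ^+ 2 * A.
  rewrite mulrC -ler_pdivrMr//; apply: le_trans NA; apply: le_trans KN.
  by rewrite /K; lra.
have ww : e0 ^+ 2 <= w ^+ 2 by rewrite ler_pXn2r// nnegrE ltW.
have ww1 : w ^+ 2 <= 1 by rewrite exprn_ile1// ltW.
have kL : e0 ^+ 2 * A <= k%:R.
  have : e0 ^+ 2 * (4 * A) <= w ^+ 2 * a.
    by apply: ler_pM => //; rewrite ?mulr_ge0// ltW.
  by move: klt; rewrite -(natr1 k); lra.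
have kU : k%:R <= 4 / e0 ^+ 3 * A.
  apply: (le_trans kle); apply: le_trans aU.
  have : w ^+ 2 * a <= 1 * a by rewrite ler_wpM2r.
  lra.
have k0 : (0 < k)%N by rewrite -(ltr_nat R); lra.
have CA : (4 * C2 / e0 ^+ 2) ^+ 2 * q <= A.
  apply: le_trans NA; apply: le_trans Kq; rewrite ler_wpM2r//; first by lra.
  by rewrite /K; lra.
have [th0 th4 thS thC] := tilt_parameters e00 ew w1 A0 q1 (ltW s0) kL kU CA.
set D := Num.sqrt (q * A) in th0 th4 thS thC *.
rewrite -/C2 in th0 th4 thS thC.
set th := C2 * w * D / k%:R in th0 th4 thS thC.
pose D1 := Num.sqrt A.
have D10 : 0 < D1 by rewrite sqrtr_gt0.
have D1E : D1 ^+ 2 = A by rewrite sqr_sqrtr// ltW.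
pose m1 := (m - k)%N.
have mE : m = (k + m1)%N by rewrite subnKC.
pose c1 := boundary_mean w m1 n - s * D1.
pose c2 := k%:R / w + D + s * D1.
have c12 : c1 + c2 = boundary_mean w m n + D.
  rewrite /c1 /c2 /boundary_mean {1}mE -addnS natrD mulrDl; ring.
have sk0 : 0 < Num.sqrt k%:R :> R by rewrite sqrtr_gt0 ltr0n.
have l0 : 0 < (w - th) / Num.sqrt k%:R by rewrite divr_gt0//; lra.
have th2 : 2 * th < w by lra.
have low Q X' : independent_exponentials Q X' (boundary_rate w (1 - w)) (strip n.+1) ->
    (forall t, X' (0%N, 0%N) t = 0) ->
    (Q [set t | (hor_lpt X' m1 n.+1 t < c1)%R] <= (4^-1)%:E)%E.
  move=> iX' X'0.
  have lw : D1^-1 <= w / 2.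
    rewrite invf_ple ?posrE ?divr_gt0// invf_div.
    rewrite -(@ler_pXn2r _ 2)// ?nnegrE ?divr_ge0 ?(ltW w0) ?(ltW D10)//.
    rewrite D1E expr_div_n ler_pdivrMr ?exprn_gt0//.
    apply: (@le_trans _ _ (e0 ^+ 2 * A)); last by rewrite mulrC ler_pM2l.
    by apply: le_trans eA; rewrite expr2; lra.
  have hw : eta * Dl <= (1 - w) / 2.
    have e01 : e0 <= 1 by lra.
    have : e0 ^+ 3 * Dl <= e0 * 1.
      apply: ler_pM; rewrite ?exprn_ge0 ?(ltW e00) ?(ltW Dl0)//.
      by rewrite exprS ler_piMr ?(ltW e00)// exprn_ile1 ?(ltW e00).
    by rewrite /eta; lra.
  have eta0 : 0 < eta by rewrite divr_gt0// exprn_gt0.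
  have h0 : 0 < eta * Dl by exact: mulr_gt0.
  have x0 : 0 <= s * D1 by rewrite mulr_ge0 ?ltW.
  have iD1 : 0 < D1^-1 by rewrite invr_gt0.
  have := hor_lower_tail m1 w0 w1 iD1 lw h0 hw x0 iX' X'0.
  set a' := m1.+1%:R / w ^+ 2 - _; set b' := m1.+1%:R / w ^+ 3 + _.
  have a'E : a' = a - k%:R / w ^+ 2.
    by rewrite /a' /a {1}mE -addnS natrD mulrDl; ring.
  have kw : k%:R / w ^+ 2 <= a / 2.
    by rewrite ler_pdivrMr ?exprn_gt0//; lra.
  have kw0 : 0 <= k%:R / w ^+ 2 by rewrite divr_ge0// exprn_ge0// ltW.
  have a'L : 2 * (N * Dl) <= a' by rewrite a'E -/A; lra.
  have a'U : a' <= 4 / e0 ^+ 3 * (N * Dl) by rewrite a'E -/A; lra.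
  have b'0 : 0 <= b' by rewrite addr_ge0// divr_ge0// exprn_ge0// ltW.
  have b'U : b' <= N / e0 ^+ 3.
    have inv3 u : e0 <= u -> (u ^+ 3)^-1 <= (e0 ^+ 3)^-1.
      move=> eu; rewrite lef_pV2 ?posrE ?exprn_gt0//; last by lra.
      by rewrite ler_pXn2r// nnegrE; lra.
    rewrite /b' /N mulrDl lerD//; apply: ler_pM;
      rewrite ?invr_ge0 ?exprn_ge0 ?inv3 ?(ltW w0) ?(ltW w1')//.
    - by rewrite ler_nat ltnS leq_subr.
    - by lra.
  have K1 : 1 <= N * Dl ^+ 3 by apply: le_trans KN; rewrite /K; lra.
  have K2 : (2 * s / eta) ^+ 2 <= N * Dl ^+ 3 by apply: le_trans KN; rewrite /K; lra.
  have := lower_tail_parameters e00 N0 Dl0 (lexx s) a'L a'U b'0 b'U K1 K2.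
  move=> par tail; have {par tail} := le_trans tail par.
  rewrite -/A -/D1 -/(boundary_mean w m1 n) -/c1 ler_pM2l ?mulr_gt0// => Qle.
  have mhor := measurable_hor_lpt m1 iX'.
  rewrite -[leLHS]fineK ?lee_fin// ge0_fin_numE//.
  rewrite (@le_lt_trans _ _ 1%E) ?ltry// -(indep_setT iX').
  by rewrite le_measure ?inE//; exact: measurable_lt_set.
have Sbound := gamma_lower_chernoff (v := w - th) (c := c2) (k := k) _ k0 _.
have {}Sbound : expR ((w - th) / Num.sqrt k%:R * c2) *
    ((w - th) / (w - th + (w - th) / Num.sqrt k%:R)) ^+ k <= 4^-1.
  apply: Sbound; first by lra.
  have -> : (w - th) * c2 = k%:R - k%:R * th / w + (w - th) * (D + s * D1).
    by rewrite /c2; field; rewrite gt_eqF.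
  have : (w - th) * (D + s * D1) <= 1 * (D + s * D1).
    rewrite ler_wpM2r//; last by lra.
    by rewrite addr_ge0 ?sqrtr_ge0// mulr_ge0 ?ltW.
  by move: thS; rewrite -/D1; lra.
have := upper_tail_lower_bound iX X0 r0 w1 th0 th2 l0 (low d T) Sbound.
rewrite -mE c12; apply: le_trans.
rewrite lee_fin lef_pV2 ?posrE ?mulr_gt0 ?expR_gt0//; last first.
  by rewrite exprn_gt0// divr_gt0 ?exprn_gt0 ?mulr_gt0//; lra.
by rewrite ler_pM2l// tilt_cost_le.
Qed.

End upper_tail.

(** * Moments and reflection *)

Section moments.
Context {R : realType}.

Lemma moment_ge_tail d (T : measurableType d) (P : probability T R) (f : T -> R) (M D p b : R) :
  measurable_fun setT f -> 0 <= D -> 0 <= p ->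
  (b%:E <= P [set t | (M + D <= f t)%R])%E ->
  ((D `^ p * b)%:E <= 'E_P[fun t => (`|f t - M| `^ p)%R])%E.
Proof.
move=> mf D0 p0 bP; rewrite unlock.
have mA := measurable_ge_set (M + D) mf.
apply: (@le_trans _ _ (\int[P]_t ((D `^ p)%:E * (\1_[set t | (M + D <= f t)%R] t)%:E))%E).
  rewrite ge0_integralZl//; last 2 first.
  - by apply/measurable_EFinP; exact: measurable_indic.
  - by rewrite lee_fin powR_ge0.
  by rewrite integral_indic// setIT EFinM lee_wpmul2l// lee_fin powR_ge0.
apply: ge0_le_integral => //.
- by move=> t _; rewrite mule_ge0// lee_fin powR_ge0.
- by apply: emeasurable_funM => //; apply/measurable_EFinP; exact: measurable_indic.
- apply/measurable_EFinP.
  apply: (@measurableT_comp _ _ _ _ _ _ (@powR R ^~ p)).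
    exact: measurable_powR.
  by apply: measurableT_comp => //; exact: measurable_funB.
move=> t _; rewrite -EFinM lee_fin indicE.
case: (boolP (t \in _)) => [/set_mem/= Mf|_]; last by rewrite mulr0 powR_ge0.
rewrite mulr1; apply: ge0_ler_powR; rewrite ?nnegrE//.
by rewrite (le_trans _ (ler_norm _))//; lra.
Qed.

Lemma sqrt_powR (x p : R) : 0 <= x -> Num.sqrt x `^ p = x `^ (p / 2).
Proof. by move=> x0; rewrite -powR12_sqrt// -powRrM mulrC. Qed.

(** Both sides as powers: the factor 1/4 and exp (- C q) are absorbed in [c0]
    since p >= 1 and q <= p. *)
Lemma moment_constant (c C N Dl p q : R) :
  0 < c -> c <= 1 -> 0 < C -> 0 < N -> 0 < Dl -> 1 <= p -> q <= p -> c * p <= q ->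
  (Num.sqrt c * (expR (- C) / 4)) `^ p * p `^ (p / 2) * Dl `^ (p / 2) * N `^ (p / 2) <=
  Num.sqrt (q * (N * Dl)) `^ p * (4 * expR (C * q))^-1.
Proof.
move=> c0 c1 C0 N0 Dl0 p1 qp cpq.
have p0 : 0 < p by lra.
have cp0 : 0 < c * p by exact: mulr_gt0.
have q0 : 0 < q by lra.
have A0 : 0 < N * Dl by exact: mulr_gt0.
have E0 := expR_gt0 (- C).
rewrite powRM ?sqrtr_ge0 ?divr_ge0 ?(ltW E0)//.
rewrite !sqrt_powR ?mulr_ge0 ?(ltW c0) ?(ltW q0) ?(ltW N0) ?(ltW Dl0)//.
have -> : c `^ (p / 2) * (expR (- C) / 4) `^ p * p `^ (p / 2) * Dl `^ (p / 2) * N `^ (p / 2)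
    = (c * p * (N * Dl)) `^ (p / 2) * (expR (- C) / 4) `^ p.
  have [c0' p0' N0' Dl0'] := And4 (ltW c0) (ltW p0) (ltW N0) (ltW Dl0).
  have [cp0' A0'] := conj (ltW cp0) (ltW A0).
  by rewrite !powRM//; ring.
apply: ler_pM; rewrite ?powR_ge0//.
  have cpA : 0 <= c * p * (N * Dl) by rewrite mulr_ge0 ?ltW.
  have qA : 0 <= q * (N * Dl) by rewrite mulr_ge0 ?ltW.
  by apply: ge0_ler_powR; rewrite ?nnegrE ?ler_pM2r//; lra.
have e1 : expR (- C) `^ p <= (expR (C * q))^-1.
  by rewrite -expRM -expRN ler_expR; nra.
have e2 : (4^-1 : R) `^ p <= 4^-1 by apply: ge1r_powR => //; lra.
by rewrite powRM ?(ltW E0)// invfM mulrC ler_pM ?powR_ge0.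
Qed.

Lemma cube_powR (x y : R) : 0 <= x -> 0 <= y ->
  (x `^ 3^-1 * y `^ (- 3^-1)) ^+ 3 = x / y.
Proof.
move=> x0 y0; rewrite exprMn -!powR_mulrn ?powR_ge0// -!powRrM mulVf//.
by rewrite mulNr mulVf// powRr1// powR_inv1.
Qed.

Lemma l1norm_pt (v : nat * nat) : l1norm (pt v) = v.1%:R + v.2%:R :> R.
Proof. by rewrite /l1norm /pt/= !ger0_norm. Qed.

Lemma zeta_compl (x : R * R) : 0 < x.1 -> 0 < x.2 -> zeta (x.2, x.1) = 1 - zeta x.
Proof.
move=> x1 x2; rewrite /zeta/=.
have s1 : 0 < Num.sqrt x.1 by rewrite sqrtr_gt0.
have s2 : 0 < Num.sqrt x.2 by rewrite sqrtr_gt0.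
by field; rewrite !gt_eqF// addr_gt0.
Qed.

Lemma cone_zeta_le delta (x : R * R) : 0 < delta -> cone delta x ->
  Num.sqrt delta / (1 + Num.sqrt delta) <= 1 - zeta x.
Proof.
move=> d0 [x1 x2 _ dx]; rewrite -zeta_compl// /zeta/=.
have s1 : 0 < Num.sqrt x.1 by rewrite sqrtr_gt0.
have s2 : 0 < Num.sqrt x.2 by rewrite sqrtr_gt0.
have sd : 0 < Num.sqrt delta by rewrite sqrtr_gt0.
have : Num.sqrt delta * Num.sqrt x.1 <= Num.sqrt x.2.
  by rewrite -sqrtrM ?ler_wsqrtr// ltW.
move=> h; rewrite ler_pdivrMr ?addr_gt0// mulrAC ler_pdivlMr ?addr_gt0//; lra.
Qed.

(** [q] is capped at tau N because when the minimum in the hypothesis is [eps],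
    N Delta^3 is only known to exceed eps^3 N; as p <= T N, capping costs a constant
    factor. *)
Lemma hor_moment (delta eps T : R) : 0 < delta -> 0 < eps -> 0 < T ->
  exists (c0 K0 : R) (N0 : nat), [/\ 0 < c0, 0 < K0, (0 < N0)%N &
    forall d (Omega : measurableType d) (P : probability Omega R)
      (X : nat * nat -> Omega -> R) (v : nat * nat) (p w r : R),
    independent_exponentials P X (boundary_rate w r) nonorigin ->
    (forall t, X (0%N, 0%N) t = 0) -> 0 < r ->
    cone delta (pt v) -> (N0 <= v.1)%N -> (N0 <= v.2)%N ->
    1 <= p -> p <= T * l1norm (pt v) -> eps <= w ->
    w <= zeta (pt v) -
      Num.min (K0 * p `^ (3^-1) * l1norm (pt v) `^ (- 3^-1)) eps ->
    ((c0 `^ p * p `^ (p / 2) * (zeta (pt v) - w) `^ (p / 2) *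
      l1norm (pt v) `^ (p / 2))%:E <=
      'E_P[fun t => (`|hor_lpt X v.1.-1 v.2 t - Mfun w (pt v)| `^ p)%R])%E].
Proof.
move=> d0 eps0 T0.
pose e0 := Num.min eps (Num.sqrt delta / (1 + Num.sqrt delta)).
have sd : 0 < Num.sqrt delta by rewrite sqrtr_gt0.
have e00 : 0 < e0 by rewrite lt_min eps0 divr_gt0// addr_gt0.
have [K [C [K1 C0 tail]]] := hor_upper_tail e00.
have K0 : 0 < K by lra.
pose tau := eps ^+ 3 / K.
have tau0 : 0 < tau by rewrite divr_gt0// exprn_gt0.
pose c := Num.min 1 (tau / T).
have c_gt0 : 0 < c by rewrite lt_min ltr01 divr_gt0.
(* N0 > 1 / tau makes tau N, hence q, at least 1 *)
exists (Num.sqrt c * (expR (- C) / 4)), K, (Num.truncn tau^-1).+1; split => //.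
  by rewrite mulr_gt0 ?sqrtr_gt0// divr_gt0// expR_gt0.
move=> d Omega P X [[|m] [|n]] p w r iX X0 r0 cv Nm Nn p1 pT ew wz //.
set z := zeta _ in wz *; set N := l1norm _ in pT wz *.
have NE : N = m.+1%:R + n.+1%:R by rewrite /N l1norm_pt.
have N0 : 0 < N by rewrite NE addr_gt0.
pose q := Num.min p (tau * N).
have q1 : 1 <= q.
  rewrite le_min p1/= -ler_pdivrMl// mulr1 (le_trans (ltW (truncnS_gt _)))//.
  apply: (@le_trans _ _ m.+1%:R); first by rewrite ler_nat.
  by rewrite NE lerDl.
have p0 : 0 < p by lra.
pose mn := Num.min (K * p `^ (3^-1) * N `^ (- 3^-1)) eps.
have mn0 : 0 < mn by rewrite lt_min eps0 andbT !mulr_gt0 ?powR_gt0.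
have Dl0 : 0 < z - w by move: wz; rewrite -/mn; lra.
have mnDl : mn <= z - w by move: wz; rewrite -/mn; lra.
have Kq : K * q <= N * (z - w) ^+ 3.
  apply: (@le_trans _ _ (N * mn ^+ 3)); last first.
    by rewrite ler_pM2l// ler_pXn2r// nnegrE ltW.
  rewrite /mn; case: (leP (K * p `^ (3^-1) * N `^ (- 3^-1)) eps) => _.
    rewrite -mulrA exprMn cube_powR ?(ltW p0) ?(ltW N0)//.
    have -> : N * (K ^+ 3 * (p / N)) = K ^+ 3 * p by field; rewrite gt_eqF.
    apply: ler_pM; rewrite ?(ltW K0)//; first by lra.
      by rewrite exprS ler_peMr ?(ltW K0)// exprn_ege1.
    by rewrite ge_min lexx.
  have -> : N * eps ^+ 3 = K * (tau * N) by rewrite /tau; field; rewrite gt_eqF.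
  by rewrite ler_pM2l// ge_min lexx orbT.
have ez : e0 <= 1 - z.
  by apply: le_trans (cone_zeta_le d0 cv); rewrite ge_min lexx orbT.
have e0w : e0 <= w by apply: le_trans ew; rewrite ge_min lexx.
have wz' : w < z by lra.
have mG : measurable_fun setT (hor_lpt X m n.+1).
  by apply: (@measurable_hor_lpt _ _ _ P _ (boundary_rate w r)); apply: (indep_ext iX) => i /andP[].
have := tail _ _ P X w r q m n iX X0 r0 e0w ez wz' q1; rewrite -NE => /(_ Kq).
move=> /(moment_ge_tail mG (sqrtr_ge0 _) (ltW p0)); apply: le_trans.
rewrite lee_fin; apply: moment_constant => //.
- by rewrite ge_min lexx.
- by rewrite ge_min lexx.
rewrite /q /c le_min; apply/andP; split.
  by rewrite ler_piMl ?(ltW p0)// ge_min lexx.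
apply: (@le_trans _ _ (tau / T * p)); first by rewrite ler_pM2r// ge_min lexx orbT.
by rewrite -mulrA ler_pM2l// mulrC ler_pdivrMr// mulrC.
Qed.

End moments.

Lemma boundary_weights_indep (R : realType) d (Omega : measurableType d)
    (P : probability Omega R) (w z : R) (om : nat * nat -> {RV P >-> R}) :
  0 < w -> z < 1 -> is_boundary_weights w z om ->
  independent_exponentials P (fun p => om p) (boundary_rate w (1 - z)) nonorigin.
Proof.
move=> w0 z1 bw; split.
- by move=> p _; exact: measurable_funPT.
- by move=> p _; rewrite /boundary_rate; do 2 case: ifP => // _; rewrite subr_gt0.
move=> s A us /allP Ds mA.
transitivity (\prod_(i <- s) P (om i @^-1` A i))%E.
  by apply: (weights_indep bw us) => i _; exact: mA.
apply: eq_big_seq => -[i j] /Ds; rewrite /nonorigin /boundary_rate xpair_eqE /= => ij.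
case: j ij => [|j]; case: i => [|i] //= _.
- exact: (weights_hor bw).
- exact: (weights_ver bw).
- exact: (weights_bulk bw).
Qed.

Lemma transposed_weights_indep (R : realType) d (T : measurableType d)
    (Q : {measure set T -> \bar R}) (X : nat * nat -> T -> R) (w r : R) :
  independent_exponentials Q X (boundary_rate w r) nonorigin ->
  independent_exponentials Q (fun p => X (p.2, p.1)) (boundary_rate r w) nonorigin.
Proof.
move=> iX; have := @indep_reindex _ _ _ _ _ _ _ _ _ nonorigin
  (fun p => (p.2, p.1)) (fun p => (p.2, p.1)) iX.
move=> /(_ _)/indep_ext; apply=> -[a b]; rewrite /nonorigin xpair_eqE.
  by move=> ab; rewrite xpair_eqE andbC.
move=> ab; split; rewrite ?xpair_eqE//.
by rewrite /boundary_rate/=; move: ab; case: a => [|a]; case: b.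
Qed.

Lemma lpp_hor_lpt (R : realType) d (T : measurableType d) (X : nat * nat -> T -> R) v t :
  (0 < v.1)%N -> lpp (fun p => X p t) (1%N, 0%N) v = hor_lpt X v.1.-1 v.2 t.
Proof.
by case: v => [[|m] n] //= _; rewrite (lpp_lprec _ (1%N, 0%N) m n).
Qed.

Lemma lpp_ver_transpose (R : realType) d (T : measurableType d)
    (X : nat * nat -> T -> R) v t : (0 < v.2)%N ->
  lpp (fun p => X p t) (0%N, 1%N) v =
  hor_lpt (fun p => X (p.2, p.1)) v.2.-1 v.1 t.
Proof.
case: v => [m [|n]] //= _; rewrite (lpp_lprec _ (0%N, 1%N) m n).
by rewrite -lprec_transpose.
Qed.

Theorem theorem2p11 (R : realType) (delta eps T : R)
    (delta_gt0 : 0 < delta) (eps_gt0 : 0 < eps) (T_gt0 : 0 < T) :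
  exists (c0 K0 : R) (N0 : nat), [/\ 0 < c0, 0 < K0, (0 < N0)%N &
    forall (v : nat * nat) (p w z : R),
      cone delta (pt v) -> (N0 <= v.1)%N -> (N0 <= v.2)%N ->
      1 <= p -> p <= T * l1norm (pt v) ->
      0 < w -> z < 1 ->
    forall (d : measure_display) (Omega : measurableType d)
      (P : probability Omega R) (om : nat * nat -> {RV P >-> R}),
      is_boundary_weights w z om ->
    (eps <= w ->
     w <= zeta (pt v) -
       Num.min (K0 * p `^ (3^-1) * l1norm (pt v) `^ (- 3^-1)) eps ->
     ((c0 `^ p * p `^ (p / 2) * (zeta (pt v) - w) `^ (p / 2) *
       l1norm (pt v) `^ (p / 2))%:E <=
       'E_P[fun t => (`|Ghor om v t - Mfun w (pt v)| `^ p)%R])%E)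
    /\
    (zeta (pt v) +
       Num.min (K0 * p `^ (3^-1) * l1norm (pt v) `^ (- 3^-1)) eps <= z ->
     z <= 1 - eps ->
     ((c0 `^ p * p `^ (p / 2) * (z - zeta (pt v)) `^ (p / 2) *
       l1norm (pt v) `^ (p / 2))%:E <=
       'E_P[fun t => (`|Gver om v t - Mfun z (pt v)| `^ p)%R])%E)].
Proof.
have [c0 [K0 [N0 [c0_gt0 K0_gt0 N0_gt0 moment]]]] := hor_moment delta_gt0 eps_gt0 T_gt0.
exists c0, K0, N0; split => // v p w z cv Nv1 Nv2 p1 pT w0 z1 d Omega P om bw.
have iX := boundary_weights_indep w0 z1 bw.
have om0 := weights_origin bw.
split => [epsw wz|zz zeps].
  have GE t : Ghor om v t = hor_lpt (fun p => om p) v.1.-1 v.2 t.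
    by apply: lpp_hor_lpt; exact: leq_trans Nv1.
  rewrite (_ : (fun t => _) = (fun t =>
      `|hor_lpt (fun p => om p) v.1.-1 v.2 t - Mfun w (pt v)| `^ p)); last first.
    by apply/funext => t; rewrite GE.
  by apply: (moment _ _ _ _ _ _ _ _ iX om0) => //; lra.
have GE t : Gver om v t = hor_lpt (fun p => om (p.2, p.1)) v.2.-1 v.1 t.
  by apply: (lpp_ver_transpose (fun p => om p)); exact: leq_trans Nv2.
have [x1 x2 c1 c2] := cv.
pose v' := (v.2, v.1).
have zE : zeta (pt v') = 1 - zeta (pt v) :> R by exact: (zeta_compl x1 x2).
have NE : l1norm (pt v') = l1norm (pt v) :> R by rewrite /l1norm addrC.
have ME : Mfun (1 - z) (pt v') = Mfun z (pt v) by rewrite /Mfun subKr addrC.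
rewrite (_ : (fun t => _) = (fun t =>
    `|hor_lpt (fun p => om (p.2, p.1)) v'.1.-1 v'.2 t - Mfun (1 - z) (pt v')| `^ p)); last first.
  by apply/funext => t; rewrite ME GE.
rewrite -NE (_ : z - zeta (pt v) = zeta (pt v') - (1 - z)); last by rewrite zE; ring.
apply: (moment _ _ _ _ _ _ _ _ (transposed_weights_indep iX)) => //.
- by rewrite NE.
- by lra.
- by rewrite zE NE; lra.
Qed.
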